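(* Let $K$ be a field of characteristic $0$, let $E$ be the (infinite-dimensional, unitary) Grassmann algebra over $K$ with even part $E_0$, and let \[A=\begin{pmatrix} E_0 & E\\ 0 & E\end{pmatrix}.\] Let $n\geq 1$ be an even number and let $F_n(A)=K\langle x_1,\dots,x_n\rangle/(K\langle x_1,\dots,x_n\rangle\cap T(A))$ be the relatively free algebra of rank $n$ of the variety generated by $A$. Then the T-ideal $T(F_n(A))$ of polynomial identities of $F_n(A)$ is generated (as a T-ideal of $K\langle X\rangle$) by \[[x_1,x_2][x_3,x_4,x_5]\quad\text{and}\quad [x_1,x_2][x_3,x_4]\cdots[x_{n+3},x_{n+4}].\] Moreover, $T(F_n(A))=T(F_{n+1}(A))$.
   Context: All algebras are associative and unitary over $K$. $K\langle X\rangle$ is the free unitary associative algebra on $X=\{x_1,x_2,\dots\}$. For an algebra $R$, $T(R)$ is the ideal of all polynomials of $K\langle X\rangle$ that are polynomial identities of $R$. The Grassmann algebra $E$ is generated by $e_1,e_2,\dots$ subject to $e_ie_j=-e_je_i$; it has basis $1$ and the products $e_{i_1}\cdots e_{i_k}$ with $i_1<\dots<i_k$, and $E_0$ (resp. $E_1$) is the span of those basis products of even (resp. odd) length. Commutators are $[a,b]=ab-ba$ and $[a_1,\dots,a_k]=[[a_1,\dots,a_{k-1}],a_k]$. A T-ideal is an ideal invariant under all endomorphisms of $K\langle X\rangle$; the T-ideal generated by a set $S$ is the smallest T-ideal containing $S$. *)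

(* Defs.v *)
From HB Require Import structures.
From mathcomp Require Import all_boot all_order all_algebra.
Set Implicit Arguments. Unset Strict Implicit. Unset Printing Implicit Defensive.
Import Order.TTheory GRing.Theory Num.Theory.
Local Open Scope ring_scope.

Section FreeAlg.
Variable K : fieldType.

(* An element of K<X> (X = {x_0, x_1, ...}, i.e. x_{i+1} of the paper is
   variable i here) is represented by a finite formal linear combination of
   words: a list of (coefficient, word).  Two representations denote the same
   polynomial iff all their coefficients agree ([peq]). *)
Definition ncpoly := seq (K * seq nat).

Definition pcoef (f : ncpoly) (w : seq nat) : K := \sum_(t <- f | t.2 == w) t.1.
Definition peq (f g : ncpoly) : Prop := forall w, pcoef f w = pcoef g w.

Definition pzero : ncpoly := [::].
Definition pone : ncpoly := [:: (1, [::])].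
Definition pvar (i : nat) : ncpoly := [:: (1, [:: i])].
Definition padd (f g : ncpoly) : ncpoly := f ++ g.
Definition pscale (c : K) (f : ncpoly) : ncpoly := [seq (c * t.1, t.2) | t <- f].
Definition pmul (f g : ncpoly) : ncpoly :=
  [seq (t.1 * s.1, t.2 ++ s.2) | t <- f, s <- g].

Definition pmonsubst (sigma : nat -> ncpoly) (w : seq nat) : ncpoly :=
  foldr (fun i acc => pmul (sigma i) acc) pone w.
Definition psubst (sigma : nat -> ncpoly) (f : ncpoly) : ncpoly :=
  flatten [seq pscale t.1 (pmonsubst sigma t.2) | t <- f].

Definition pcomm (a b : ncpoly) : ncpoly := padd (pmul a b) (pscale (-1) (pmul b a)).
Definition pcommn (a : ncpoly) (l : seq ncpoly) : ncpoly := foldl pcomm a l.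

Definition in_vars (n : nat) (f : ncpoly) : Prop :=
  forall t, t \in f -> all (fun i => (i < n)%N) t.2.

Definition is_T_ideal (I : ncpoly -> Prop) : Prop :=
  (forall f g, peq f g -> I f -> I g) /\
  I pzero /\
  (forall f g, I f -> I g -> I (padd f g)) /\
  (forall c f, I f -> I (pscale c f)) /\
  (forall f g, I f -> I (pmul g f) /\ I (pmul f g)) /\
  (forall sigma f, I f -> I (psubst sigma f)).

Definition T_ideal_gen (S : ncpoly -> Prop) (f : ncpoly) : Prop :=
  forall I, is_T_ideal I -> (forall s, S s -> I s) -> I f.

(* An element of E is represented as a formal linear combination of words
   in the generators e_0, e_1, ... (same carrier type [ncpoly]); product is
   concatenation of words.  Modulo e_i e_j = - e_j e_i, a word w equals 0 if it
   has a repeated letter and (-1)^(inversions w) e_S otherwise, where S is the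
   increasing rearrangement of w.  [ecoef x S] is the coefficient of x on the
   basis element e_S (S strictly increasing). *)
Fixpoint inversions (w : seq nat) : nat :=
  if w is a :: t then count (fun b => (b < a)%N) t + inversions t else 0.

Definition ecoef (x : ncpoly) (S : seq nat) : K :=
  \sum_(t <- x | uniq t.2 && perm_eq t.2 S) (t.1 * (-1) ^+ inversions t.2).

Definition ezero (x : ncpoly) : Prop :=
  forall S, sorted ltn S -> ecoef x S = 0.

Definition in_E0 (x : ncpoly) : Prop :=
  forall S, sorted ltn S -> odd (size S) -> ecoef x S = 0.

(* (a, b, c) represents the matrix [[a, b], [0, c]] *)
Definition Amat := (ncpoly * ncpoly * ncpoly)%type.
Definition Aone : Amat := (pone, pzero, pone).
Definition Azero : Amat := (pzero, pzero, pzero).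
Definition Aadd (m m' : Amat) : Amat :=
  let: (a, b, c) := m in let: (a', b', c') := m' in
  (padd a a', padd b b', padd c c').
Definition Ascale (k : K) (m : Amat) : Amat :=
  let: (a, b, c) := m in (pscale k a, pscale k b, pscale k c).
Definition Amul (m m' : Amat) : Amat :=
  let: (a, b, c) := m in let: (a', b', c') := m' in
  (pmul a a', padd (pmul a b') (pmul b c'), pmul c c').
Definition Ais_zero (m : Amat) : Prop :=
  let: (a, b, c) := m in [/\ ezero a, ezero b & ezero c].
Definition Ain (m : Amat) : Prop := in_E0 m.1.1.

Definition Amon (phi : nat -> Amat) (w : seq nat) : Amat :=
  foldr (fun i acc => Amul (phi i) acc) Aone w.
Definition Aeval (phi : nat -> Amat) (f : ncpoly) : Amat :=
  foldr Aadd Azero [seq Ascale t.1 (Amon phi t.2) | t <- f].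

Definition T_A (f : ncpoly) : Prop :=
  forall phi : nat -> Amat, (forall i, Ain (phi i)) -> Ais_zero (Aeval phi f).

(* T(F_n(A)), F_n(A) = K<x_1..x_n> / (K<x_1..x_n> ∩ T(A)): f is an identity of
   F_n(A) iff every evaluation of f at elements of K<x_1,...,x_n> lands in
   K<x_1..x_n> ∩ T(A), i.e. (literal unfolding of the quotient). *)
Definition T_Fn (n : nat) (f : ncpoly) : Prop :=
  forall sigma : nat -> ncpoly, (forall i, in_vars n (sigma i)) ->
    T_A (psubst sigma f).

Definition gen1 : ncpoly :=
  pmul (pcomm (pvar 0) (pvar 1)) (pcommn (pvar 2) [:: pvar 3; pvar 4]).
Definition comm_prod (k : nat) : ncpoly :=
  foldr (fun i acc => pmul (pcomm (pvar i.*2) (pvar i.*2.+1)) acc) pone (iota 0 k).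
Definition gen2 (n : nat) : ncpoly := comm_prod (n./2 + 2)%N.

End FreeAlg.

(* Main.v *)
(** Write n = 2m, let C be the commutator ideal and J the T-ideal generated by
    the two polynomials.

    J is contained in T(F_(n+1)(A)): both generators are a commutator times a
    factor that vanishes in the lower right corner.  For the second one, the
    values in E of polynomials in n+1 elements c_i are even modulo the ideal
    generated by the odd parts of the c_i; a product of m+1 commutators of such
    values lies in the (n+2)-nd power of that ideal, which is 0.

    Conversely let f be in T(F_n(A)).  Sorted words are a Schreier transversal
    of F/C, so f is a combination of sorted words plus a sum of b_(t,k) g_(t,k)
    where b_(t,k) = t x_k - sort(t x_k).  Elements of F_n(A) can be evaluated at
    n matrices so that the values of the variables are (alpha_i, delta_ij; phi_i)
    with arbitrary scalars alpha_i and with phi_i = r_i or r_i + e_k, k < n.  The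
    diagonal entry kills the combination of sorted words; the (1,2) entry is a
    polynomial in alpha whose coefficients, taken by descending |t|, yield
    g_(t,k)(phi) = 0.  Now g_(t,k) is reduced modulo [a,b,c] to a combination of
    x^u [x_i1,x_i2]...[x_i(2q-1),x_i2q] with i1 < ... < i2q; these evaluations
    force all coefficients with q <= m to vanish.  Hence C g_(t,k) lies in J. *)
Require Import Defs.
From HB Require Import structures.
From mathcomp Require Import all_boot all_order all_algebra.
From mathcomp Require monalg.
Import GRing.Theory.
Local Open Scope ring_scope.
Set Implicit Arguments. Unset Strict Implicit. Unset Printing Implicit Defensive.

(** * Linear combinations of words *)

Lemma key_sumE (K : fieldType) (T : eqType) (V : lmodType K) (h : T -> V)
    (s : seq (K * T)) (P : pred T) (ks : seq T) :
  uniq ks -> {subset [seq t.2 | t <- s] <= ks} ->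
  \sum_(t <- s | P t.2) t.1 *: h t.2 =
  \sum_(k <- ks | P k) (\sum_(t <- s | t.2 == k) t.1) *: h k.
Proof.
move=> uks sub; under [RHS]eq_bigr do rewrite scaler_suml.
rewrite (exchange_big_dep (fun t => P t.2)) /=; last by move=> k t Pk /eqP ->.
rewrite big_seq_cond [RHS]big_seq_cond; apply: eq_bigr => t /andP [ts Pt].
have tk : t.2 \in ks by apply/sub/map_f.
rewrite (eq_bigl (pred1 t.2)) => [|k]; last first.
  by rewrite /= eq_sym; case: eqP => [->|]; rewrite ?Pt ?andbF.
by rewrite -big_filter filter_pred1_uniq // big_seq1.
Qed.

(** A key may be listed several times, so only total coefficients are known to vanish; regrouping by
    key carries this over to values in a module. The keys will be words, or pairs of words. *)
Lemma key_sum0 (K : fieldType) (T : eqType) (V : lmodType K) (h : T -> V)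
    (s : seq (K * T)) (P : pred T) :
  (forall k, P k -> \sum_(t <- s | t.2 == k) t.1 = 0) ->
  \sum_(t <- s | P t.2) t.1 *: h t.2 = 0.
Proof.
move=> z; rewrite (@key_sumE _ _ _ h s P (undup [seq t.2 | t <- s])) ?undup_uniq //.
  by rewrite big1 // => k Pk; rewrite z // scale0r.
by move=> k; rewrite mem_undup.
Qed.

Section LinearExtension.
Variable K : fieldType.

Definition lsum (V : lmodType K) (m : seq nat -> V) (f : ncpoly K) : V :=
  \sum_(t <- f) t.1 *: m t.2.

Variables (V : lmodType K) (m : seq nat -> V).

Lemma lsum_add f g : lsum m (padd f g) = lsum m f + lsum m g.
Proof. exact: big_cat. Qed.

Lemma lsum_scale c f : lsum m (pscale c f) = c *: lsum m f.
Proof.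
by rewrite /lsum big_map scaler_sumr; apply: eq_bigr => t _; rewrite scalerA.
Qed.

Lemma lsum_flatten (ff : seq (ncpoly K)) :
  lsum m (flatten ff) = \sum_(f <- ff) lsum m f.
Proof.
elim: ff => [|f ff IH]; first by rewrite /lsum !big_nil.
by rewrite /= [LHS]lsum_add big_cons IH.
Qed.

Lemma lsum_word (c : K) w : lsum m [:: (c, w)] = c *: m w.
Proof. exact: big_seq1. Qed.

Lemma lsum_nil : lsum m [::] = 0.
Proof. exact: big_nil. Qed.

Lemma lsum_coef f ws : uniq ws -> {subset [seq t.2 | t <- f] <= ws} ->
  lsum m f = \sum_(w <- ws) pcoef f w *: m w.
Proof. exact: (@key_sumE K _ V m f predT). Qed.

Lemma lsum_peq f g : peq f g -> lsum m f = lsum m g.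
Proof.
move=> fg; pose ws := undup [seq t.2 | t <- f ++ g].
rewrite (@lsum_coef f ws) ?undup_uniq // => [|w]; last first.
  by rewrite mem_undup map_cat mem_cat => ->.
rewrite (@lsum_coef g ws) ?undup_uniq // => [|w]; last first.
  by rewrite mem_undup map_cat mem_cat orbC => ->.
by apply: eq_bigr => w _; rewrite fg.
Qed.

Lemma lsum_mul (f g : ncpoly K) :
  lsum m (pmul f g) =
  \sum_(t <- f) \sum_(s <- g) (t.1 * s.1) *: m (t.2 ++ s.2).
Proof. by rewrite /lsum big_allpairs_dep. Qed.

End LinearExtension.

(** * Evaluations in algebras and the (1,2) entry of triangular evaluations *)

Section Evaluation.
Variables (K : fieldType) (R : algType K).
Implicit Types (a b c phi : nat -> R) (f g : ncpoly K).

Definition mon phi (w : seq nat) : R := \prod_(i <- w) phi i.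
Definition ev phi f : R := lsum (mon phi) f.

(** The (1,2) entry of the product along [w] of the triangular matrices with diagonal a_i, c_i and
    corner b_i. Hence the twisted Leibniz rule [dev_mul]. *)
Fixpoint dmon a b c (w : seq nat) : R :=
  if w is i :: w' then a i * dmon a b c w' + b i * mon c w' else 0.
Definition dev a b c f : R := lsum (dmon a b c) f.

Lemma mon_nil phi : mon phi [::] = 1. Proof. exact: big_nil. Qed.
Lemma mon_cons phi i w : mon phi (i :: w) = phi i * mon phi w.
Proof. exact: big_cons. Qed.
Lemma mon_cat phi u v : mon phi (u ++ v) = mon phi u * mon phi v.
Proof. exact: big_cat. Qed.

Lemma mon_scalar (alpha : nat -> K) w :
  mon (fun i => alpha i *: 1) w = (\prod_(i <- w) alpha i) *: 1.
Proof.
elim: w => [|i w IH]; first by rewrite mon_nil big_nil scale1r.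
by rewrite mon_cons IH big_cons -scalerAl mul1r scalerA.
Qed.

Lemma dmon_cat a b c u v :
  dmon a b c (u ++ v) = mon a u * dmon a b c v + dmon a b c u * mon c v.
Proof.
elim: u => [|i u IH] /=; first by rewrite mon_nil mul1r mul0r addr0.
by rewrite IH mon_cons mon_cat !mulrDr mulrDl !mulrA addrA.
Qed.

Lemma ev_add phi f g : ev phi (padd f g) = ev phi f + ev phi g.
Proof. exact: lsum_add. Qed.
Lemma ev_scale phi k f : ev phi (pscale k f) = k *: ev phi f.
Proof. exact: lsum_scale. Qed.
Lemma ev_zero phi : ev phi (pzero K) = 0.
Proof. exact: lsum_nil. Qed.
Lemma ev_one phi : ev phi (pone K) = 1.
Proof. by rewrite /ev lsum_word mon_nil scale1r. Qed.
Lemma ev_var phi i : ev phi (pvar K i) = phi i.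
Proof. by rewrite /ev lsum_word scale1r mon_cons mon_nil mulr1. Qed.
Lemma ev_mul phi f g : ev phi (pmul f g) = ev phi f * ev phi g.
Proof.
rewrite /ev lsum_mul /lsum mulr_suml; apply: eq_bigr => t _.
rewrite mulr_sumr; apply: eq_bigr => s _.
by rewrite mon_cat -scalerA -scalerAl -!scalerAr.
Qed.

Definition comm (x y : R) := x * y - y * x.

Lemma commDl x y z : comm (x + y) z = comm x z + comm y z.
Proof. by rewrite /comm mulrDl mulrDr opprD addrACA. Qed.
Lemma commDr x y z : comm z (x + y) = comm z x + comm z y.
Proof. by rewrite /comm mulrDl mulrDr opprD addrACA. Qed.

Lemma ev_comm phi f g : ev phi (pcomm f g) = comm (ev phi f) (ev phi g).
Proof. by rewrite ev_add ev_scale !ev_mul scaleN1r. Qed.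

Lemma ev_subst phi sigma f :
  ev phi (psubst sigma f) = ev (fun i => ev phi (sigma i)) f.
Proof.
rewrite /ev lsum_flatten big_map; apply: eq_bigr => t _.
rewrite lsum_scale; congr (_ *: _); rewrite -/(ev phi _).
elim: (t.2) => [|i w IH] /=; first by rewrite ev_one mon_nil.
by rewrite ev_mul IH mon_cons.
Qed.

Lemma dev_add a b c f g : dev a b c (padd f g) = dev a b c f + dev a b c g.
Proof. exact: lsum_add. Qed.
Lemma dev_scale a b c k f : dev a b c (pscale k f) = k *: dev a b c f.
Proof. exact: lsum_scale. Qed.
Lemma dev_zero a b c : dev a b c (pzero K) = 0.
Proof. exact: lsum_nil. Qed.
Lemma dev_one a b c : dev a b c (pone K) = 0.
Proof. by rewrite /dev lsum_word scaler0. Qed.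
Lemma dev_var a b c i : dev a b c (pvar K i) = b i.
Proof. by rewrite /dev lsum_word scale1r /= mulr0 add0r mon_nil mulr1. Qed.
Lemma dev_mul a b c f g :
  dev a b c (pmul f g) = ev a f * dev a b c g + dev a b c f * ev c g.
Proof.
rewrite /dev lsum_mul /ev /lsum !mulr_suml -big_split; apply: eq_bigr => t _.
rewrite !mulr_sumr -big_split; apply: eq_bigr => s _ /=.
by rewrite dmon_cat -scalerA !scalerDr -!scalerAl -!scalerAr.
Qed.

Lemma dev_subst a b c sigma f :
  dev a b c (psubst sigma f) =
  dev (fun i => ev a (sigma i)) (fun i => dev a b c (sigma i))
      (fun i => ev c (sigma i)) f.
Proof.
rewrite /dev lsum_flatten big_map; apply: eq_bigr => t _.
rewrite lsum_scale; congr (_ *: _); rewrite -/(dev a b c _).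
elim: (t.2) => [|i w IH] /=; first by rewrite dev_one.
rewrite dev_mul IH; congr (_ + _ * _).
elim: w {IH} => [|j w IH] /=; first by rewrite ev_one mon_nil.
by rewrite ev_mul IH mon_cons.
Qed.

Lemma eq_mon phi phi' : phi =1 phi' -> mon phi =1 mon phi'.
Proof. by move=> e w; apply: eq_bigr => i _; apply: e. Qed.
Lemma eq_ev phi phi' f : phi =1 phi' -> ev phi f = ev phi' f.
Proof. by move=> e; apply: eq_bigr => t _; rewrite (eq_mon e). Qed.
Lemma eq_dev a b c a' b' c' f : a =1 a' -> b =1 b' -> c =1 c' ->
  dev a b c f = dev a' b' c' f.
Proof.
move=> ea eb ec; apply: eq_bigr => t _; congr (_ *: _).
by elim: (t.2) => //= i w ->; rewrite ea eb (eq_mon ec).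
Qed.

End Evaluation.

(** * The Grassmann algebra on N generators *)

Section Sign.
Variables (K : fieldType) (N : nat).
Implicit Types T U V : {set 'I_N}.

Definition cross T U : nat := \sum_(i in T) \sum_(j in U) (j < i)%N.
(* The structure constants: e_T e_U = esign T U e_(T u U). *)
Definition esign T U : K := if [disjoint T & U] then (-1) ^+ cross T U else 0.

Lemma sum_setU T U (F : 'I_N -> nat) : [disjoint T & U] ->
  (\sum_(i in T :|: U) F i = \sum_(i in T) F i + \sum_(i in U) F i)%N.
Proof.
by move=> dTU; rewrite -bigU //; apply: eq_bigl => i; rewrite !inE.
Qed.

Lemma crossUl T U V : [disjoint T & U] ->
  cross (T :|: U) V = (cross T V + cross U V)%N.
Proof. by move=> dTU; rewrite /cross sum_setU. Qed.

Lemma crossUr T U V : [disjoint U & V] ->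
  cross T (U :|: V) = (cross T U + cross T V)%N.
Proof.
by move=> dUV; rewrite /cross -big_split; apply: eq_bigr => i _; rewrite sum_setU.
Qed.

Lemma disjoint_setUl T U V :
  [disjoint T :|: U & V] = [disjoint T & V] && [disjoint U & V].
Proof. by rewrite !disjoints_subset subUset. Qed.

Lemma disjoint_setUr T U V :
  [disjoint T & U :|: V] = [disjoint T & U] && [disjoint T & V].
Proof.
by rewrite disjoint_sym disjoint_setUl ![[disjoint T & _]]disjoint_sym.
Qed.

(** Both sides vanish unless the sets are pairwise disjoint, and then both count the crossings of
    all three pairs. This cocycle identity makes the product associative. *)
Lemma esign_cocycle T U V :
  esign T U * esign (T :|: U) V = esign U V * esign T (U :|: V).
Proof.
rewrite /esign disjoint_setUl disjoint_setUr.
have [dTU|_] := boolP [disjoint T & U]; last by rewrite mul0r mulr0.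
have [dUV|_] := boolP [disjoint U & V]; last by rewrite andbF mul0r mulr0.
have [dTV|_] := boolP [disjoint T & V]; last by rewrite !mulr0.
rewrite crossUl ?crossUr // -!exprD.
by congr (_ ^+ _); rewrite [RHS]addnC -addnA.
Qed.

Lemma esign0l U : esign set0 U = 1.
Proof. by rewrite /esign /cross big_set0 disjoints_subset sub0set. Qed.

Lemma esign0r T : esign T set0 = 1.
Proof.
rewrite /esign disjoint_sym disjoints_subset sub0set /cross big1 // => i _.
by rewrite big_set0.
Qed.

(** For disjoint sets each pair in [T] times [U] is counted by exactly one of [cross T U] and
    [cross U T]. *)
Lemma esignC T U : esign T U = (-1) ^+ (#|T| * #|U|) * esign U T.
Proof.
rewrite /esign [[disjoint U & T]]disjoint_sym; case: ifPn => [dTU|]; last first.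
  by rewrite mulr0.
suff -> : (#|T| * #|U| = cross T U + cross U T)%N.
  by rewrite exprD -mulrA -expr2 sqrr_sign mulr1.
rewrite /cross [X in (_ + X)%N]exchange_big -big_split /= -sum_nat_const.
apply: eq_bigr => i iT; rewrite -sum1_card -big_split /=.
apply: eq_bigr => j jU; case: ltngtP => // /val_inj eij.
by move: dTU; rewrite disjoint_subset => /subsetP /(_ i iT); rewrite inE -eij jU.
Qed.

End Sign.

Section GrassmannRing.
Variables (K : fieldType) (N : nat).

Definition grass := {ffun {set 'I_N} -> K}.
HB.instance Definition _ := GRing.Zmodule.copy grass {ffun {set 'I_N} -> K}.

Definition gscale (k : K) (x : grass) : grass := [ffun S => k * x S].
Fact gscaleA k l x : gscale k (gscale l x) = gscale (k * l) x.
Proof. by apply/ffunP => S; rewrite !ffunE mulrA. Qed.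
Fact gscale1 : left_id 1 gscale.
Proof. by move=> x; apply/ffunP => S; rewrite ffunE mul1r. Qed.
Fact gscaleDr : right_distributive gscale +%R.
Proof. by move=> k x y; apply/ffunP => S; rewrite !ffunE mulrDr. Qed.
Fact gscaleDl x : {morph gscale^~ x : k l / k + l}.
Proof. by move=> k l; apply/ffunP => S; rewrite !ffunE mulrDl. Qed.
HB.instance Definition _ := GRing.Zmodule_isLmodule.Build K grass
  gscaleA gscale1 gscaleDr gscaleDl.

Implicit Types (x y z : grass) (T U V S : {set 'I_N}).

Definition gdelta T : grass := [ffun S => (S == T)%:R].
Definition gone : grass := gdelta set0.
Definition gmul x y : grass :=
  [ffun S => \sum_T \sum_U (T :|: U == S)%:R * esign K T U * (x T * y U)].

Lemma gmulA : associative gmul.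
Proof.
move=> x y z; apply/ffunP => S; rewrite !ffunE.
(* Both bracketings become this sum over triples: the index A of the inner product is forced to be
   the union of U and V here, and of T and U in the second half. *)
transitivity (\sum_T \sum_U \sum_V (T :|: U :|: V == S)%:R *
   (esign K T U * esign K (T :|: U) V) * (x T * y U * z V)).
  apply: eq_bigr => T _.
  under eq_bigr => A _.
    rewrite ffunE mulr_sumr mulr_sumr.
    under eq_bigr => U _ do rewrite !mulr_sumr.
    over.
  rewrite exchange_big; apply: eq_bigr => U _.
  rewrite exchange_big; apply: eq_bigr => V _ /=.
  rewrite (bigD1 (U :|: V)) //= big1 ?addr0; last first.
    by move=> A /negPf nA; rewrite [U :|: V == A]eq_sym nA !(mul0r, mulr0).
  rewrite eqxx mul1r setUA esign_cocycle.
  by rewrite -!mulrA; congr (_ * _); rewrite [RHS]mulrCA; congr (_ * _);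
     rewrite mulrCA.
symmetry; under eq_bigr => A _.
  under eq_bigr => V _.
    rewrite ffunE mulr_suml mulr_sumr.
    under eq_bigr => T _ do rewrite mulr_suml mulr_sumr.
    over.
  rewrite exchange_big.
  under eq_bigr => T _ do rewrite exchange_big.
  over.
rewrite exchange_big; apply: eq_bigr => T _.
rewrite exchange_big; apply: eq_bigr => U _.
rewrite exchange_big; apply: eq_bigr => V _ /=.
rewrite (bigD1 (T :|: U)) //= big1 ?addr0; last first.
  by move=> A /negPf nA; rewrite [T :|: U == A]eq_sym nA !(mul0r, mulr0).
rewrite eqxx mul1r -!mulrA; congr (_ * _).
by rewrite mulrCA.
Qed.

Lemma gmul_deltal T y S :
  gmul (gdelta T) y S = \sum_U (T :|: U == S)%:R * esign K T U * y U.
Proof.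
rewrite ffunE (bigD1 T) //= [X in _ + X]big1 ?addr0.
  by apply: eq_bigr => U _; rewrite ffunE eqxx mul1r.
move=> A /negPf nA; rewrite big1 // => U _; rewrite ffunE nA.
by rewrite mul0r mulr0.
Qed.

Lemma gmul1x : left_id gone gmul.
Proof.
move=> y; apply/ffunP => S; rewrite gmul_deltal (bigD1 S) //= big1 ?addr0.
  by rewrite set0U eqxx esign0l !mul1r.
by move=> U /negPf nU; rewrite set0U nU !mul0r.
Qed.

Lemma gmulx1 : right_id gone gmul.
Proof.
move=> x; apply/ffunP => S; rewrite ffunE (bigD1 S) //= [X in _ + X]big1 ?addr0.
  rewrite (bigD1 set0) //= big1 ?addr0.
    by rewrite setU0 eqxx esign0r ffunE eqxx !mul1r mulr1.
  by move=> U /negPf nU; rewrite !ffunE nU !mulr0.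
move=> T /negPf nT; rewrite (bigD1 set0) //= big1 ?addr0.
  by rewrite setU0 nT !mul0r.
by move=> U /negPf nU; rewrite !ffunE nU !mulr0.
Qed.

Lemma gmulDl : left_distributive gmul +%R.
Proof.
move=> x y z; apply/ffunP => S; rewrite !ffunE -big_split; apply: eq_bigr => T _.
rewrite -big_split; apply: eq_bigr => U _ /=.
by rewrite ffunE mulrDl mulrDr.
Qed.

Lemma gmulDr : right_distributive gmul +%R.
Proof.
move=> x y z; apply/ffunP => S; rewrite !ffunE -big_split; apply: eq_bigr => T _.
rewrite -big_split; apply: eq_bigr => U _ /=.
by rewrite ffunE mulrDr mulrDr.
Qed.

Lemma gone_neq0 : gone != 0.
Proof.
by apply/eqP => /ffunP /(_ set0) /eqP; rewrite !ffunE eqxx oner_eq0.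
Qed.

HB.instance Definition _ := GRing.Zmodule_isNzRing.Build grass
  gmulA gmul1x gmulx1 gmulDl gmulDr gone_neq0.

Lemma gscaleAl (k : K) x y : k *: (x * y) = (k *: x) * y.
Proof.
apply/ffunP => S; rewrite !ffunE mulr_sumr; apply: eq_bigr => T _.
rewrite mulr_sumr; apply: eq_bigr => U _.
by rewrite ffunE mulrCA !mulrA.
Qed.
HB.instance Definition _ := GRing.Lmodule_isLalgebra.Build K grass gscaleAl.

Lemma gscaleAr (k : K) x y : k *: (x * y) = x * (k *: y).
Proof.
apply/ffunP => S; rewrite !ffunE mulr_sumr; apply: eq_bigr => T _.
rewrite mulr_sumr; apply: eq_bigr => U _.
by rewrite ffunE mulrCA; congr (_ * _); rewrite mulrCA.
Qed.
HB.instance Definition _ := GRing.Lalgebra_isAlgebra.Build K grass gscaleAr.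

Lemma grassM x y S : (x * y) S =
  \sum_T \sum_U (T :|: U == S)%:R * esign K T U * (x T * y U).
Proof. exact: ffunE. Qed.

Lemma gdelta_mul T U : gdelta T * gdelta U = esign K T U *: gdelta (T :|: U).
Proof.
apply/ffunP => S; rewrite [LHS]gmul_deltal (bigD1 U) //= big1 ?addr0.
  by rewrite !ffunE eqxx mulr1 eq_sym mulrC.
by move=> V /negPf nV; rewrite ffunE nV mulr0.
Qed.

Definition geven x := forall S, odd #|S| -> x S = 0.
Definition godd x := forall S, ~~ odd #|S| -> x S = 0.
Definition evpart x : grass := [ffun S : {set 'I_N} => if odd #|S| then 0 else x S].
Definition odpart x : grass := [ffun S : {set 'I_N} => if odd #|S| then x S else 0].

Lemma evpart_even x : geven (evpart x).
Proof. by move=> S; rewrite ffunE => ->. Qed.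
Lemma odpart_odd x : godd (odpart x).
Proof. by move=> S; rewrite ffunE => /negPf ->. Qed.
Lemma parts x : x = evpart x + odpart x.
Proof. by apply/ffunP => S; rewrite !ffunE; case: ifP; rewrite ?add0r ?addr0. Qed.

Lemma even_central x y : geven x -> x * y = y * x.
Proof.
move=> xe; apply/ffunP => S; rewrite !grassM exchange_big; apply: eq_bigr => U _.
apply: eq_bigr => T _; have [oT|eT] := boolP (odd #|T|).
  by rewrite xe // mul0r !mulr0.
by rewrite setUC esignC -signr_odd oddM (negPf eT) mul1r [x T * _]mulrC.
Qed.

Lemma odd_anticomm x y : godd x -> godd y -> x * y = - (y * x).
Proof.
move=> xo yo; apply/ffunP => S; rewrite [RHS]ffunE !grassM exchange_big -sumrN.
apply: eq_bigr => U _; rewrite -sumrN; apply: eq_bigr => T _.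
have [oT|eT] := boolP (odd #|T|); last by rewrite xo // mul0r !mulr0 oppr0.
have [oU|eU] := boolP (odd #|U|); last by rewrite yo // mul0r !mulr0 oppr0.
by rewrite setUC esignC -signr_odd oddM oT oU mulN1r mulrN mulNr [x T * _]mulrC.
Qed.

Lemma evenD x y : geven x -> geven y -> geven (x + y).
Proof. by move=> xe ye S oS; rewrite ffunE xe // ye // addr0. Qed.
Lemma evenZ k x : geven x -> geven (k *: x).
Proof. by move=> xe S oS; rewrite ffunE xe // mulr0. Qed.
Lemma even1 : geven 1.
Proof. by move=> S; rewrite ffunE; case: eqP => // ->; rewrite cards0. Qed.
Lemma even0 : geven 0.
Proof. by move=> S _; rewrite ffunE. Qed.
Lemma evenM x y : geven x -> geven y -> geven (x * y).
Proof.
move=> xe ye S oS; rewrite grassM big1 // => T _; rewrite big1 // => U _.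
have [oT|eT] := boolP (odd #|T|); first by rewrite xe // mul0r mulr0.
have [oU|eU] := boolP (odd #|U|); first by rewrite ye // !mulr0.
case: eqP => [e|]; last by rewrite !mul0r.
rewrite /esign; case: ifP => [dTU|]; last by rewrite mulr0 mul0r.
move: oS; rewrite -e cardsU; move: dTU; rewrite -setI_eq0 => /eqP ->.
by rewrite cards0 subn0 oddD (negPf eT) (negPf eU).
Qed.

(** [h] commutes with the even part of [g] and anticommutes with the odd part, so [g'] is the image
    of [g] under the parity automorphism. *)
Lemma odd_swap (h : grass) g : godd h -> exists g', g * h = h * g'.
Proof.
move=> ho; exists (evpart g - odpart g).
rewrite {1}(parts g) mulrDl mulrBr even_central; last exact: evpart_even.
by rewrite (odd_anticomm (odpart_odd g) ho).
Qed.

(** Letters beyond [N] go to 0, so evaluation at [ge] is the projection of E onto the Grassmann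
    algebra on N generators. *)
Definition ge (i : nat) : grass :=
  if insub i is Some j then gdelta [set j] else 0.

Lemma ge_ord (j : 'I_N) : ge j = gdelta [set j].
Proof. by rewrite /ge valK. Qed.

Lemma ge_odd i : godd (ge i).
Proof.
move=> S; rewrite /ge; case: insubP => [j _ _|_]; last by rewrite ffunE.
by rewrite ffunE; case: eqP => // ->; rewrite cards1.
Qed.

Definition wset (w : seq nat) : {set 'I_N} := [set j : 'I_N | val j \in w].

Lemma mon_ge w : mon ge w =
  if uniq w && all (fun i => i < N)%N w
  then (-1) ^+ inversions w *: gdelta (wset w) else 0.
Proof.
elim: w => [|i w IH].
  have -> : wset [::] = set0 by apply/setP => j; rewrite !inE.
  by rewrite mon_nil scale1r.
rewrite mon_cons IH /=; have [iN|nN] := ltnP i N; last first.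
  rewrite [ge i]/ge insubN -?leqNgt // mul0r.
  by case: ifP => // /and3P [].
case: ifP => [/andP [uw aw]|uaw]; last by rewrite -andbA uaw !andbF mulr0.
rewrite uw aw !andbT -scalerAr -[i]/(val (Ordinal iN)) ge_ord gdelta_mul scalerA.
rewrite /esign disjoints1 inE /=; case: ifP => // _; last by rewrite mulr0 scale0r.
have -> : [set Ordinal iN] :|: wset w = wset (i :: w).
  by apply/setP => j; rewrite !inE -val_eqE.
rewrite addnC exprD /cross big_set1; congr (_ * (_ ^+ _) *: _).
transitivity (\sum_(b <- w) (b < i))%N; last first.
  by rewrite -sum1_count [RHS]big_mkcond; apply: eq_bigr => b _; case: ifP.
rewrite -[RHS](@perm_big _ _ _ _ (filter (mem w) (iota 0 N)) w) /=.
  rewrite big_filter -[N in iota 0 N]subn0 (big_mkord (fun b => b \in w)).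
  by apply: eq_bigl => j; rewrite inE.
apply: uniq_perm => [|//|b]; first by rewrite filter_uniq ?iota_uniq.
by rewrite mem_filter mem_iota /= andb_idr // => /(allP aw).
Qed.

End GrassmannRing.

(** * Reduction of E and of T(A) to finitely many Grassmann generators *)

Section Truncation.
Variable K : fieldType.

Definition gtrunc N (x : ncpoly K) : grass K N := ev (@ge K N) x.

(** Words with a letter outside the first N die under truncation, but they do not contribute to e_S
    either. *)
Lemma ecoef_gtrunc N (x : ncpoly K) S : sorted ltn S -> all (fun i => i < N)%N S ->
  ecoef x S = gtrunc N x (wset N S).
Proof.
move=> sS aS; have uS : uniq S by apply: sorted_uniq sS; [exact: ltn_trans|exact: ltnn].
rewrite /ecoef /gtrunc /ev /lsum sum_ffunE big_mkcond; apply: eq_bigr => t _.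
rewrite ffunE mon_ge; case: (boolP (uniq t.2)) => [ut|_] /=; last by rewrite ffunE mulr0.
have [pS|npS] := boolP (perm_eq t.2 S).
  rewrite (perm_all _ pS) aS !ffunE; suff -> : wset N t.2 = wset N S by rewrite eqxx mulr1.
  by apply/setP => j; rewrite !inE (perm_mem pS).
case: ifP => [at2|_]; last by rewrite ffunE mulr0.
rewrite !ffunE; case: eqP => [eS|_]; last by rewrite !mulr0.
case/negP: npS; apply: uniq_perm => // b.
apply/idP/idP => bt.
  have bN : (b < N)%N by apply: (allP at2).
  by have := in_set (fun j : 'I_N => val j \in t.2) (Ordinal bN); rewrite -/(wset N _) -eS inE /= bt.
have bN : (b < N)%N by apply: (allP aS).
by have := in_set (fun j : 'I_N => val j \in S) (Ordinal bN); rewrite -/(wset N _) eS inE /= bt.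
Qed.

Definition eseq N (S : {set 'I_N}) : seq nat :=
  [seq i <- iota 0 N | i \in [seq val j | j in S]].

Lemma eseq_sorted N (S : {set 'I_N}) : sorted ltn (eseq S).
Proof. by apply: sorted_filter; [exact: ltn_trans|exact: iota_ltn_sorted]. Qed.

Lemma eseq_bound N (S : {set 'I_N}) : all (fun i => i < N)%N (eseq S).
Proof. by apply/allP => i; rewrite mem_filter mem_iota => /and3P []. Qed.

Lemma wset_eseq N (S : {set 'I_N}) : wset N (eseq S) = S.
Proof.
apply/setP => j; rewrite inE mem_filter mem_iota /= ltn_ord andbT.
by rewrite mem_map ?mem_enum //; apply: val_inj.
Qed.

Lemma size_eseq N (S : {set 'I_N}) : size (eseq S) = #|S|.
Proof.
rewrite cardE -(size_map val); apply: perm_size; apply: uniq_perm => [||i].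
- by rewrite filter_uniq ?iota_uniq.
- by rewrite map_inj_uniq ?enum_uniq //; apply: val_inj.
rewrite mem_filter mem_iota /= andb_idr // => /mapP [j _ ->]; exact: ltn_ord.
Qed.

Lemma gtruncE N (x : ncpoly K) S : gtrunc N x S = ecoef x (eseq S).
Proof. by rewrite (@ecoef_gtrunc N) ?eseq_sorted ?eseq_bound // wset_eseq. Qed.

(** Each coefficient involves finitely many generators, so a large enough truncation sees it. *)
Lemma ezeroP (x : ncpoly K) : ezero x <-> forall N, gtrunc N x = 0.
Proof.
split=> [zx N|zx S sS].
  by apply/ffunP => S; rewrite gtruncE zx ?eseq_sorted // ffunE.
rewrite (@ecoef_gtrunc (\max_(i <- S) i).+1) ?zx ?ffunE //.
by apply/allP => i iS; rewrite ltnS; apply: leq_bigmax_seq.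
Qed.

Lemma in_E0_even N (x : ncpoly K) : in_E0 x -> geven (gtrunc N x).
Proof. by move=> xe S oS; rewrite gtruncE xe ?eseq_sorted ?size_eseq. Qed.

Lemma gtrunc_one N : gtrunc N (pone K) = 1. Proof. exact: ev_one. Qed.
Lemma gtrunc_zero N : gtrunc N (pzero K) = 0. Proof. exact: ev_zero. Qed.

Section AEval.
Variables (N : nat) (phi : nat -> Amat K).
Let a i := gtrunc N (phi i).1.1.
Let b i := gtrunc N (phi i).1.2.
Let c i := gtrunc N (phi i).2.

Lemma Amon_gtrunc w :
  [/\ gtrunc N (Amon phi w).1.1 = mon a w,
      gtrunc N (Amon phi w).1.2 = dmon a b c w &
      gtrunc N (Amon phi w).2 = mon c w].
Proof.
elim: w => [|i w [IHa IHb IHc]]; first by rewrite /= !mon_nil gtrunc_one gtrunc_zero.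
rewrite /= !mon_cons -IHa -IHb -IHc /a /b /c.
case: (phi i) => [[x y] z]; case: (Amon phi w) => [[x' y'] z'] /=.
by rewrite /gtrunc ev_add !ev_mul.
Qed.

Lemma Aeval_gtrunc f :
  [/\ gtrunc N (Aeval phi f).1.1 = ev a f,
      gtrunc N (Aeval phi f).1.2 = dev a b c f &
      gtrunc N (Aeval phi f).2 = ev c f].
Proof.
elim: f => [|t f [IHa IHb IHc]].
  by rewrite /= gtrunc_zero /ev /dev !lsum_nil.
rewrite /ev /dev /lsum !big_cons -!/(lsum _ _) -/(ev _ _) -/(dev _ _ _ _) -/(ev _ _).
have [<- <- <-] := Amon_gtrunc t.2.
rewrite -IHa -IHb -IHc.
rewrite -[Aeval phi (t :: f)]/(Aadd (Ascale t.1 (Amon phi t.2)) (Aeval phi f)).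
case: (Amon phi _) => [[x y] z]; case: (Aeval phi f) => [[x' y'] z'] /=.
by split; rewrite /gtrunc [LHS]ev_add ev_scale.
Qed.
End AEval.

Lemma Ais_zeroP (M : Amat K) : Ais_zero M <->
  forall N, [/\ gtrunc N M.1.1 = 0, gtrunc N M.1.2 = 0 & gtrunc N M.2 = 0].
Proof.
case: M => [[x y] z] /=; split => [[/ezeroP zx /ezeroP zy /ezeroP zz] N|H] //.
by split; apply/ezeroP => N; case: (H N).
Qed.

Lemma T_AP (f : ncpoly K) : T_A f <->
  forall phi, (forall i, Ain (phi i)) -> forall N,
    let a i := gtrunc N (phi i).1.1 in
    let b i := gtrunc N (phi i).1.2 in
    let c i := gtrunc N (phi i).2 in
    [/\ ev a f = 0, dev a b c f = 0 & ev c f = 0].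
Proof.
split=> H phi phiA.
  by move=> N /=; have [<- <- <-] := Aeval_gtrunc N phi f; have /Ais_zeroP := H phi phiA.
by apply/Ais_zeroP => N; have [-> -> ->] := Aeval_gtrunc N phi f; exact: H.
Qed.

End Truncation.

Section InVars.
Variables (K : fieldType) (k : nat).
Implicit Types f g : ncpoly K.

Lemma in_vars_cat f g : in_vars k f -> in_vars k g -> in_vars k (f ++ g).
Proof. by move=> vf vg t; rewrite mem_cat => /orP [/vf|/vg]. Qed.

Lemma in_vars_scale c f : in_vars k f -> in_vars k (pscale c f).
Proof. by move=> vf t /mapP [s /vf vs ->]. Qed.

Lemma in_vars_mul f g : in_vars k f -> in_vars k g -> in_vars k (pmul f g).
Proof.
move=> vf vg t /allpairsP [[u v] /= [/vf vu /vg vv ->]] /=.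
by rewrite all_cat vu.
Qed.

Lemma in_vars_one : in_vars k (pone K).
Proof. by move=> t; rewrite inE => /eqP ->. Qed.

Lemma in_vars_var i : (i < k)%N -> in_vars k (pvar K i).
Proof. by move=> ik t; rewrite inE => /eqP -> /=; rewrite ik. Qed.

Lemma in_vars_subst sigma f :
  (forall i, in_vars k (sigma i)) -> in_vars k (psubst sigma f).
Proof.
move=> vs; elim: f => [|t f IH] //=; apply: in_vars_cat => //.
apply: in_vars_scale; elim: (t.2) => [|i w IHw]; first exact: in_vars_one.
exact: in_vars_mul.
Qed.

End InVars.

(** * The ideal generated by finitely many odd elements *)

Section OddIdeal.
Variables (K : fieldType) (char2 : 2%:R != 0 :> K) (N : nat).
Local Notation G := (grass K N).
Implicit Types (x y z g : G).

Lemma oddM x y : godd x -> godd y -> geven (x * y).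
Proof.
move=> xe ye S oS; rewrite grassM big1 // => T _; rewrite big1 // => U _.
have [oT|eT] := boolP (odd #|T|); last by rewrite xe // mul0r mulr0.
have [oU|eU] := boolP (odd #|U|); last by rewrite ye // !mulr0.
case: eqP => [e|]; last by rewrite !mul0r.
rewrite /esign; case: ifP => [dTU|]; last by rewrite mulr0 mul0r.
move: oS; rewrite -e cardsU; move: dTU; rewrite -setI_eq0 => /eqP ->.
by rewrite cards0 subn0 oddD oT oU.
Qed.

Lemma comm_even_shift x y x' y' : geven x -> geven y ->
  comm (x + x') (y + y') = comm x' y'.
Proof.
move=> xe ye; rewrite commDl [comm x _]/comm (even_central _ xe) subrr add0r.
by rewrite commDr [comm x' y]/comm (even_central x' ye) subrr add0r.
Qed.

Lemma comm_grass_even x y : geven (comm x y).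
Proof.
rewrite (parts x) (parts y) comm_even_shift; try exact: evpart_even.
apply: evenD; first by apply: oddM; apply: odpart_odd.
by rewrite -scaleN1r; apply/evenZ/oddM; apply: odpart_odd.
Qed.

Lemma comm_comm_grass x y z : comm (comm x y) z = 0.
Proof. by rewrite {1}/comm (even_central z (comm_grass_even x y)) subrr. Qed.

Lemma odd_sq x : godd x -> x * x = 0.
Proof.
move=> xo; have /eqP := odd_anticomm xo xo; rewrite -subr_eq0 opprK -mulr2n.
by rewrite -scaler_nat scaler_eq0 (negPf char2) => /eqP.
Qed.

(** The parity automorphism, which rewrites right multiples of odd elements as left multiples. *)
Definition ginv x : G := evpart x - odpart x.

Lemma ginv_odd x h : godd h -> h * x = ginv x * h.
Proof.
move=> ho; rewrite {1}(parts x) mulrDr mulrBl.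
rewrite -(even_central h (evpart_even x)).
by rewrite (odd_anticomm ho (odpart_odd x)).
Qed.

Section Generators.
Variables (k : nat) (h : nat -> G) (h_odd : forall i, godd (h i)).

Lemma mon_odd_mem j l : j \in l -> h j * mon h l = 0.
Proof.
elim: l => // i l IH; rewrite inE mon_cons mulrA => /orP [/eqP ->|/IH z].
  by rewrite odd_sq ?mul0r.
by rewrite (odd_anticomm (h_odd j) (h_odd i)) mulNr -mulrA z mulr0 oppr0.
Qed.

Lemma mon_odd_dup l : ~~ uniq l -> mon h l = 0.
Proof.
elim: l => //= i l IH; rewrite negb_and negbK mon_cons => /orP [/mon_odd_mem //|/IH ->].
by rewrite mulr0.
Qed.

Lemma mon_odd_swap g l : exists g', g * mon h l = mon h l * g'.
Proof.
elim: l g => [|i l IH] g; first by exists g; rewrite mon_nil mul1r mulr1.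
have [g' e] := odd_swap g (h_odd i); have [g'' e'] := IH g'.
by exists g''; rewrite mon_cons mulrA e -mulrA e' mulrA.
Qed.

Definition inH y := exists g : nat -> G, y = \sum_(j < k) g j * h j.

(* Contains every product of r elements of the ideal generated by
   h_0, ..., h_(k-1), and is 0 for r > k. *)
Definition annih r z := forall l, all (fun j => j < k)%N l ->
  (k < r + size l)%N -> z * mon h l = 0.

(** A word of more than k letters below k repeats a letter, and odd elements anticommute and square
    to 0. *)
Lemma annih0 z : annih 0 z.
Proof.
move=> l lk sl; rewrite mon_odd_dup ?mulr0 //; apply: contraL sl => ul.
rewrite -leqNgt add0n -[k in X in (_ <= X)%N](size_iota 0); apply: uniq_leq_size => // j /(allP lk).
by rewrite mem_iota.
Qed.

(** The coefficient g_j is moved to the far right, past h_j and the monomial; then h_j is one more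
    letter of the word. *)
Lemma annih_mul r z y : annih r z -> inH y -> annih r.+1 (z * y).
Proof.
move=> az [g ->] l lk sl; rewrite mulr_sumr mulr_suml big1 // => j _.
rewrite !mulrA -[_ * h j * _]mulrA -mon_cons -mulrA.
have [g' ->] := mon_odd_swap (g j) (val j :: l).
by rewrite mulrA az ?mul0r //= ?ltn_ord // addnS.
Qed.

Lemma annihB r z z' : annih r z -> annih r z' -> annih r (z - z').
Proof. by move=> az az' l lk sl; rewrite mulrBl az // az' // subr0. Qed.

Lemma annih_comm r z y y' : annih r z -> inH y -> inH y' ->
  annih r.+2 (z * comm y y').
Proof.
move=> az Hy Hy'; rewrite mulrBr !mulrA.
by apply: annihB; apply: annih_mul => //; apply: annih_mul.
Qed.

Definition evenH x := exists x0 y, [/\ geven x0, inH y & x = x0 + y].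

Lemma inH0 : inH 0.
Proof. by exists (fun=> 0); rewrite big1 // => j _; rewrite mul0r. Qed.

Lemma inHD y y' : inH y -> inH y' -> inH (y + y').
Proof.
move=> [g ->] [g' ->]; exists (fun j => g j + g' j); rewrite -big_split.
by apply: eq_bigr => j _; rewrite mulrDl.
Qed.

Lemma inHMl x y : inH y -> inH (x * y).
Proof.
move=> [g ->]; exists (fun j => x * g j); rewrite mulr_sumr.
by apply: eq_bigr => j _; rewrite mulrA.
Qed.

Lemma inHMr x y : inH y -> inH (y * x).
Proof.
move=> [g ->]; exists (fun j => g j * ginv x); rewrite mulr_suml.
by apply: eq_bigr => j _; rewrite -!mulrA -ginv_odd.
Qed.

Lemma evenH_even x : geven x -> evenH x.
Proof. by move=> xe; exists x, 0; rewrite addr0; split=> //; apply: inH0. Qed.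

Lemma evenHD x y : evenH x -> evenH y -> evenH (x + y).
Proof.
move=> [x0 [x1 [ex Hx ->]]] [y0 [y1 [ey Hy ->]]]; exists (x0 + y0), (x1 + y1).
by split; [apply: evenD|apply: inHD|rewrite addrACA].
Qed.

Lemma evenHM x y : evenH x -> evenH y -> evenH (x * y).
Proof.
move=> [x0 [x1 [ex Hx ->]]] [y0 [y1 [ey Hy ->]]].
exists (x0 * y0), (x1 * y0 + (x0 + x1) * y1).
split; [exact: evenM| |by rewrite mulrDr mulrDl addrA].
by apply: inHD; [apply: inHMr|apply: inHMl].
Qed.

(** The elements that are even modulo the ideal form a subalgebra containing each c_j with j < k,
    because the odd part of c_j generates. *)
Lemma evenH_ev (c : nat -> G) f : (forall j, (j < k)%N -> odpart (c j) = h j) ->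
  in_vars k f -> evenH (ev c f).
Proof.
move=> ch; elim: f => [|t f IH] vf; first by rewrite ev_zero; apply/evenH_even/even0.
rewrite -[t :: f]/(padd [:: t] f) ev_add; apply: evenHD; last first.
  by apply: IH => s sf; apply: vf; rewrite inE sf orbT.
case: t vf => [s w] vf; rewrite /ev lsum_word.
rewrite -[_ *: _]mul1r -scalerAr scalerAl.
apply: evenHM; first by apply/evenH_even/evenZ/even1.
have /= {vf} := vf (s, w) (mem_head _ _).
elim: w => [_|j w IHw /= /andP [jk wk]]; first by rewrite mon_nil; apply/evenH_even/even1.
rewrite mon_cons; apply: evenHM; last exact: IHw.
exists (evpart (c j)), (odpart (c j)); split; [exact: evpart_even| |exact: parts].
exists (fun i => (i == j)%:R); rewrite ch // (bigD1 (Ordinal jk)) //= eqxx mul1r.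
by rewrite big1 ?addr0 // => i /negPf; rewrite -val_eqE /= => ->; rewrite mul0r.
Qed.

Lemma annih_commH r z x y : annih r z -> evenH x -> evenH y ->
  annih r.+2 (z * comm x y).
Proof.
move=> az [x0 [x1 [ex Hx ->]]] [y0 [y1 [ey Hy ->]]].
by rewrite comm_even_shift //; apply: annih_comm.
Qed.

(** Even summands drop out of a commutator, which leaves a commutator of two elements of the ideal.
    So each factor raises the power of the ideal by two, and powers beyond k vanish. *)
Lemma comm_prod_evenH (c : nat -> G) (s : seq nat) : (forall i, evenH (c i)) ->
  (k < (size s).*2)%N -> \prod_(i <- s) comm (c i.*2) (c i.*2.+1) = 0.
Proof.
move=> Hc; suff Hs : annih (size s).*2 (\prod_(i <- s) comm (c i.*2) (c i.*2.+1)).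
  by move=> ks; have := Hs [::]; rewrite mon_nil mulr1 addn0; apply.
elim/last_ind: s => [|s i IH]; first exact: annih0.
by rewrite size_rcons doubleS -cats1 big_cat big_seq1; apply: annih_commH.
Qed.

End Generators.
End OddIdeal.

(** * The two generators are identities of F_(n+1)(A) *)

Section EasyInclusion.
Variables (K : fieldType) (char2 : 2%:R != 0 :> K).

(** A sufficient condition for [T_Fn k], stated through matrix entries in truncations; the T-ideal
    axioms then follow from the product rules of [ev] and [dev]. *)
Definition grass_identity k (f : ncpoly K) := forall N (a b c : nat -> grass K N),
  (forall i, geven (a i)) -> forall sigma, (forall i, in_vars k (sigma i)) ->
  let a' i := ev a (sigma i) in
  let b' i := dev a b c (sigma i) in
  let c' i := ev c (sigma i) in
  [/\ ev a' f = 0, dev a' b' c' f = 0 & ev c' f = 0].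

Lemma grass_identity_T_ideal k : is_T_ideal (grass_identity k).
Proof.
split=> [f g fg If N a b c ae s vs|].
  have [Ha Hb Hc] := If N a b c ae s vs.
  by split=> [||]; [rewrite -Ha|rewrite -Hb|rewrite -Hc]; apply/esym/lsum_peq.
split=> [N a b c ae s vs a' b' c'|]; first by rewrite !ev_zero dev_zero.
split=> [f g If Ig N a b c ae s vs a' b' c'|].
  have [Ha Hb Hc] := If N a b c ae s vs; have [Ha' Hb' Hc'] := Ig N a b c ae s vs.
  by rewrite !ev_add dev_add Ha Ha' Hb Hb' Hc Hc' !addr0.
split=> [l f If N a b c ae s vs a' b' c'|].
  have [Ha Hb Hc] := If N a b c ae s vs.
  by rewrite !ev_scale dev_scale Ha Hb Hc !scaler0.
split=> [f g If|tau f If N a b c ae s vs a' b' c'].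
  split=> N a b c ae s vs a' b' c'; have [Ha Hb Hc] := If N a b c ae s vs;
  by rewrite !ev_mul dev_mul Ha Hb Hc !(mul0r, mulr0, addr0).
rewrite !ev_subst dev_subst.
have vst i : in_vars k (psubst s (tau i)) by apply: in_vars_subst.
have [Ha Hb Hc] := If N a b c ae _ vst.
split; [rewrite -[RHS]Ha|rewrite -[RHS]Hb|rewrite -[RHS]Hc].
- by apply: eq_ev => i; rewrite ev_subst.
- by apply: eq_dev => i; rewrite ?ev_subst ?dev_subst.
- by apply: eq_ev => i; rewrite ev_subst.
Qed.

Lemma grass_identity_T_Fn k f : grass_identity k f -> T_Fn k f.
Proof.
move=> If s vs; apply/T_AP => phi phiA N /=; rewrite !ev_subst dev_subst.
by apply: If => // i; apply: in_E0_even; apply: phiA.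
Qed.

Lemma ev_even N (a : nat -> grass K N) f : (forall i, geven (a i)) -> geven (ev a f).
Proof.
move=> ae; elim: f => [|[c w] f IH]; first by rewrite ev_zero; apply: even0.
rewrite -[_ :: f]/(padd [:: (c, w)] f) ev_add; apply: evenD => //.
rewrite /ev lsum_word; apply: evenZ.
by elim: w => [|i w IHw]; rewrite ?mon_nil ?mon_cons; [apply: even1|apply: evenM].
Qed.

Definition commprod_from s : ncpoly K :=
  foldr (fun i acc => pmul (pcomm (pvar K i.*2) (pvar K i.*2.+1)) acc) (pone K) s.

Lemma ev_commprod (R : algType K) (phi : nat -> R) s :
  ev phi (commprod_from s) = \prod_(i <- s) comm (phi i.*2) (phi i.*2.+1).
Proof.
elim: s => [|i s IH] /=; first by rewrite ev_one big_nil.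
by rewrite ev_mul ev_comm !ev_var IH big_cons.
Qed.

Lemma gen2E n : gen2 K n = pmul (pcomm (pvar K 0) (pvar K 1))
  (commprod_from (iota 1 n./2.+1)).
Proof. by rewrite /gen2 /comm_prod addn2. Qed.

(** The (1,2) entry of a product p q is p11 q12 + p12 q22. Here p11 = 0, being a commutator of even
    elements, and q22 = 0, since commutators in a Grassmann algebra are central. *)
Lemma gen1_identity k : grass_identity k (gen1 K).
Proof.
move=> N a b c ae s vs a' b' c'; rewrite /gen1.
rewrite -[pcommn _ _]/(pcomm (pcomm (pvar K 2) (pvar K 3)) (pvar K 4)).
rewrite !ev_mul dev_mul !ev_comm !ev_var.
have -> : comm (a' 0%N) (a' 1%N) = 0.
  by rewrite /comm (even_central (a' 1%N)) ?subrr //; apply: ev_even.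
by rewrite !comm_comm_grass !(mul0r, mulr0, addr0, add0r).
Qed.

Lemma gen2_identity n : ~~ odd n -> grass_identity n.+1 (gen2 K n).
Proof.
move=> en N a b c ae s vs a' b' c'; rewrite gen2E.
have : ev c' (commprod_from (iota 1 n./2.+1)) = 0.
  rewrite ev_commprod.
  (* After the first commutator n/2 + 1 of them remain; as n is even, their 2(n/2 + 1) = n + 2
     entries outnumber the n + 1 odd generators. *)
  apply: (@comm_prod_evenH K char2 N n.+1 (fun i => odpart (c i))) => [i|i|].
  - exact: odpart_odd.
  - by apply: evenH_ev => // j; apply: odpart_odd.
  - by rewrite size_iota doubleS even_halfK.
move: (commprod_from _) => q qz; rewrite !ev_mul dev_mul !ev_comm !ev_var.
have -> : comm (a' 0%N) (a' 1%N) = 0.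
  by rewrite /comm (even_central (a' 1%N)) ?subrr //; apply: ev_even.
by rewrite qz !(mul0r, mulr0, addr0, add0r).
Qed.

Lemma T_gen_sub n f : ~~ odd n ->
  T_ideal_gen (fun g => g = @gen1 K \/ g = @gen2 K n) f -> T_Fn n.+1 f.
Proof.
move=> en Tf; apply: grass_identity_T_Fn.
apply: Tf => [|g [->|->]]; [exact: grass_identity_T_ideal|exact: gen1_identity|].
exact: gen2_identity.
Qed.

End EasyInclusion.

Lemma T_Fn_leq (K : fieldType) k l (f : ncpoly K) : (k <= l)%N -> T_Fn l f -> T_Fn k f.
Proof.
move=> kl Tf s vs; apply: Tf => i t /vs /allP vt; apply/allP => j /vt jk.
exact: leq_trans kl.
Qed.

(** * Polynomial functions *)

Section PolynomialFunctions.
Variables (K : fieldType) (charK0 : [pchar K] =i pred0).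

Lemma poly_nat_roots (p : {poly K}) : (forall k : nat, p.[k%:R] = 0) -> p = 0.
Proof.
move=> pz; apply/eqP; apply: contraT => p0.
have := @max_poly_roots K p [seq k%:R | k <- iota 0 (size p)] p0.
rewrite size_map size_iota ltnn => -> //.
  by apply/allP => _ /mapP [k _ ->]; rewrite /root pz.
rewrite map_inj_in_uniq ?iota_uniq // => i j _ _ /eqP.
wlog ij : i j / (i <= j)%N => [W|].
  by case/orP: (leq_total i j) => [/W //|/W H e]; apply/esym/H; rewrite eq_sym.
rewrite eq_sym -subr_eq0 -natrB // (pcharf0P K).1 // subn_eq0 => ji.
by apply/eqP; rewrite eqn_leq ij.
Qed.

(** Kronecker substitution: the multiset of letters is read as a number in base [M] whose digits are
    the multiplicities. *)
Definition kronecker M (t : seq nat) : nat := \sum_(i <- t) M ^ i.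

Lemma kronecker_count M B t : all (fun i => i < B)%N t ->
  kronecker M t = (\sum_(i < B) count_mem (val i) t * M ^ i)%N.
Proof.
elim: t => [|j t IH] /=; first by rewrite /kronecker big_nil big1.
case/andP=> jB tB; rewrite /kronecker big_cons -/(kronecker M t) IH //.
under [RHS]eq_bigr do rewrite mulnDl.
rewrite big_split /=; congr (_ + _)%N; rewrite (bigD1 (Ordinal jB)) //= eqxx mul1n.
by rewrite big1 ?addn0 // => i /negPf; rewrite -val_eqE /= eq_sym => ->.
Qed.

Lemma digits_inj M B (a b : nat -> nat) :
  (forall i, a i < M)%N -> (forall i, b i < M)%N ->
  (\sum_(i < B) a i * M ^ i = \sum_(i < B) b i * M ^ i)%N ->
  forall i, (i < B)%N -> a i = b i.
Proof.
elim: B a b => [|B IH] a b aM bM; first by [].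
rewrite !big_ord_recl /= !expn0 !muln1 => e.
have M0 : (0 < M)%N by apply: leq_ltn_trans (aM 0%N).
have shift (c : nat -> nat) : (\sum_(i < B) c (bump 0 i) * M ^ (bump 0 i) =
    (\sum_(i < B) c i.+1 * M ^ i) * M)%N.
  by rewrite big_distrl; apply: eq_bigr => i _; rewrite /bump add1n expnSr mulnA.
move: e; rewrite !shift => e.
have e0 : a 0%N = b 0%N.
  have := congr1 (modn^~ M) e; rewrite ![(_ + _ * M)%N]addnC !modnMDl.
  by rewrite !modn_small.
case=> [|i] iB //; apply: (IH (fun i => a i.+1) (fun i => b i.+1)) => //.
by apply/eqP; rewrite -(eqn_pmul2r M0) -(eqn_add2l (a 0%N)) e e0.
Qed.

Lemma kronecker_inj M t u : (size t < M)%N -> (size u < M)%N ->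
  kronecker M t = kronecker M u -> perm_eq t u.
Proof.
move=> tM uM; pose B := (\max_(i <- t ++ u) i).+1.
have tuB : all (fun i => i < B)%N (t ++ u).
  by apply/allP => i itu; rewrite ltnS; apply: leq_bigmax_seq.
move: (tuB); rewrite all_cat => /andP [tB uB].
rewrite !(@kronecker_count M B) // => e.
apply/allP => i itu; apply/eqP.
apply: (digits_inj (a := fun i => count_mem i t) (b := fun i => count_mem i u) _ _ e).
- by move=> j; apply: leq_ltn_trans tM; apply: count_size.
- by move=> j; apply: leq_ltn_trans uM; apply: count_size.
- exact: (allP tuB).
Qed.

(** Setting alpha_i = z^(M^i) turns the commutative image of [f] into a univariate polynomial
    vanishing at all natural z. As [M] exceeds the length of [u] and of every word of [f], different
    multisets of letters give different exponents. *)
Lemma monomial_coef_eq0 (f : ncpoly K) :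
  (forall alpha : nat -> K, \sum_(t <- f) t.1 * \prod_(i <- t.2) alpha i = 0) ->
  forall u, \sum_(t <- f | perm_eq t.2 u) t.1 = 0.
Proof.
move=> fz u; pose M := (maxn (size u) (\max_(t <- f) size t.2)).+1.
pose p : {poly K} := \sum_(t <- f) t.1 *: 'X^(kronecker M t.2).
have p0 : p = 0.
  apply: poly_nat_roots => k; rewrite -[RHS](fz (fun i => k%:R ^+ (M ^ i))).
  rewrite /p horner_sum; apply: eq_bigr => t _; rewrite hornerZ hornerXn; congr (_ * _).
  rewrite /kronecker; elim: (t.2) => [|i w IH]; first by rewrite !big_nil.
  by rewrite !big_cons exprD IH.
have := congr1 (fun q : {poly K} => q`_(kronecker M u)) p0.
rewrite /p coef_sum coef0 => e; rewrite -[RHS]e big_mkcond big_seq [RHS]big_seq.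
apply: eq_bigr => t tf; rewrite coefZ coefXn.
case: ifP => [tu|ntu].
  by rewrite /kronecker (perm_big _ tu) eqxx mulr1.
case: eqP => [eu|]; last by rewrite mulr0.
case/negP: (negbT ntu); apply: (@kronecker_inj M) => //; rewrite ltnS.
  rewrite leq_max; apply/orP; right.
  exact: (@leq_bigmax_seq _ _ predT (fun t : K * seq nat => size t.2)).
exact: leq_maxl.
Qed.

End PolynomialFunctions.

Lemma seq2_ind (T : Type) (P : seq T -> Prop) : P [::] -> (forall a, P [:: a]) ->
  (forall a b s, P s -> P [:: a, b & s]) -> forall s, P s.
Proof.
move=> P0 P1 P2; suff H s : P s /\ forall a, P (a :: s) by move=> s; case: (H s).
elim: s => [|b s [IH1 IH2]]; first by split.
by split=> // a; apply: P2.
Qed.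

(** * Normal forms modulo triple commutators *)

Section Ideals.
Variables (K : fieldType) (R : algType K).
Implicit Types a b c d : R.

Record is_ideal (I : R -> Prop) : Prop := IsIdeal {
  ideal0 : I 0;
  idealD : forall a b, I a -> I b -> I (a + b);
  idealZ : forall k a, I a -> I (k *: a);
  idealMl : forall a b, I b -> I (a * b);
  idealMr : forall a b, I a -> I (a * b) }.

Definition lie_nilpotent (I : R -> Prop) := forall a b c, I (comm (comm a b) c).

(** Letters are consumed in pairs and an unpaired last letter is dropped, so the exchange rules need
    even length. *)
Fixpoint cm (x : nat -> R) (s : seq nat) : R :=
  if s is a :: s1 then
    if s1 is b :: s2 then comm (x a) (x b) * cm x s2 else 1
  else 1.

Lemma comm_mull a b c : comm (a * b) c = a * comm b c + comm a c * b.
Proof. by rewrite /comm mulrBr mulrBl !mulrA addrA subrK. Qed.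

Lemma comm_mulr a b c : comm a (b * c) = b * comm a c + comm a b * c.
Proof. by rewrite /comm mulrBr mulrBl !mulrA [RHS]addrC addrA subrK. Qed.

Lemma commC a b : comm a b = - comm b a.
Proof. by rewrite /comm opprB. Qed.

Variables (I : R -> Prop) (idI : is_ideal I).

Lemma idealN a : I a -> I (- a).
Proof. by move=> Ia; rewrite -scaleN1r; apply: idealZ. Qed.
Lemma idealB a b : I a -> I b -> I (a - b).
Proof. by move=> Ia Ib; apply: idealD => //; apply: idealN. Qed.

Lemma ideal_sum (T : Type) (r : seq T) (P : pred T) (F : T -> R) :
  (forall t, P t -> I (F t)) -> I (\sum_(t <- r | P t) F t).
Proof.
by move=> IF; elim/big_rec: _ => [|t y Pt Iy]; [apply: ideal0|apply: idealD => //; apply: IF].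
Qed.

Hypothesis LI : lie_nilpotent I.

(** By the Leibniz rule [[ad,c],b] is the negative of this sum plus a[[d,c],b] and [[a,c],b]d, which
    lie in [I]. *)
Lemma comm_exchange a b c d :
  I (comm a b * comm c d + comm a c * comm b d).
Proof.
have H := LI (a * d) c b; rewrite comm_mull commDl !comm_mull in H.
rewrite [comm c d]commC [comm b d]commC !mulrN -opprD; apply: idealN.
have := idealB (idealB H (idealMr idI d (LI a c b))) (idealMl idI a (LI d c b)).
by rewrite addrA addrK -[_ + _ + comm a c * _]addrA [a * _ + _]addrC addrK.
Qed.

Lemma cm_central x s c : I (c * cm x s - cm x s * c).
Proof.
elim/seq2_ind: s c => [c|i c|i j s IH c] /=; try by rewrite mulr1 mul1r subrr; apply: ideal0.
rewrite -(subrK (comm (x i) (x j) * (c * cm x s)) (c * _)) -addrA.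
apply: idealD => //; last first.
  by rewrite -!mulrA -mulrBr; apply: idealMl.
rewrite !mulrA -mulrBl; apply: idealMr => //.
by rewrite -opprB; apply: idealN; apply: LI.
Qed.

(** Two adjacent letters lie either in one commutator, which is antisymmetric, or in neighbouring
    ones, where [comm_exchange] applies. *)
Lemma cm_swap x pre (a b : nat) post : ~~ odd (size (pre ++ [:: a, b & post])) ->
  I (cm x (pre ++ [:: a, b & post]) + cm x (pre ++ [:: b, a & post])).
Proof.
elim/seq2_ind: pre => [_|p|p q pre IH] /=.
- by rewrite [comm (x b) _]commC mulNr subrr; apply: ideal0.
- case: post => [//|d post] _ /=; rewrite !mulrA -mulrDl.
  by apply: idealMr => //; apply: comm_exchange.
- by rewrite negbK => /IH H; rewrite -mulrDr; apply: idealMl.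
Qed.

Lemma ideal_half (char2 : 2%:R != 0 :> K) a : I (a + a) -> I a.
Proof.
move=> H; have := idealZ idI (2%:R)^-1 H.
by rewrite -mulr2n -scaler_nat scalerA mulVf // scale1r.
Qed.

End Ideals.

Section NormalForm.
Variables (K : fieldType) (char2 : 2%:R != 0 :> K).
Implicit Types f g : ncpoly K.

(** Congruence modulo the T-ideal of [a,b,c], expressed without a quotient: it is used both with [I]
    = 0 in Grassmann algebras and with a proper choice of [I] in the free algebra. *)
Definition Lcong f g := forall (R : algType K) (I : R -> Prop) (x : nat -> R),
  is_ideal I -> lie_nilpotent I -> I (ev x f - ev x g).

Lemma Lcong_trans f g h : Lcong f g -> Lcong g h -> Lcong f h.
Proof.
move=> fg gh R I x idI LI; rewrite -(subrK (ev x g) (ev x f)) -addrA.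
by apply: idealD => //; [apply: fg|apply: gh].
Qed.

Definition pword w : ncpoly K := [:: (1, w)].
Fixpoint pcm (s : seq nat) : ncpoly K :=
  if s is a :: s1 then
    if s1 is b :: s2 then pmul (pcomm (pvar K a) (pvar K b)) (pcm s2) else pone K
  else pone K.

Lemma ev_word (R : algType K) (x : nat -> R) w : ev x (pword w) = mon x w.
Proof. by rewrite /ev lsum_word scale1r. Qed.
Lemma ev_cm (R : algType K) (x : nat -> R) s : ev x (pcm s) = cm x s.
Proof.
elim/seq2_ind: s => [|a|a b s IH] /=; try exact: ev_one.
by rewrite ev_mul ev_comm !ev_var IH.
Qed.

Definition pterm (u s : seq nat) := pmul (pword u) (pcm s).
Definition nform := seq (K * (seq nat * seq nat)).
Definition pnf (nf : nform) : ncpoly K :=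
  flatten [seq pscale t.1 (pterm t.2.1 t.2.2) | t <- nf].
(** These are the usual normal monomials of the relatively free algebra of E: an ordered monomial
    times commutators in strictly increasing letters. *)
Definition nf_wf (t : K * (seq nat * seq nat)) :=
  [&& sorted leq t.2.1, sorted ltn t.2.2 & ~~ odd (size t.2.2)].

Lemma ev_term (R : algType K) (x : nat -> R) u s : ev x (pterm u s) = mon x u * cm x s.
Proof. by rewrite ev_mul ev_word ev_cm. Qed.

Lemma ev_pnf (R : algType K) (x : nat -> R) nf :
  ev x (pnf nf) = \sum_(t <- nf) t.1 *: (mon x t.2.1 * cm x t.2.2).
Proof.
rewrite /ev lsum_flatten big_map; apply: eq_bigr => t _.
by rewrite lsum_scale -/(ev _ _) ev_term.
Qed.

Definition NFable f := exists2 nf, all nf_wf nf & Lcong f (pnf nf).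

Lemma NFable_cong f g : Lcong f g -> NFable g -> NFable f.
Proof. by move=> fg [nf wf gn]; exists nf => //; apply: Lcong_trans gn. Qed.

Lemma NFable_eq f g : (forall (R : algType K) (x : nat -> R), ev x f = ev x g) ->
  NFable g -> NFable f.
Proof.
move=> fg; apply: NFable_cong => R I x idI _.
by rewrite fg subrr; apply: ideal0.
Qed.

Lemma NFable_zero : NFable (pzero K).
Proof. by exists [::] => // R I x idI _; rewrite subrr; apply: ideal0. Qed.

Lemma NFable_add f g : NFable f -> NFable g -> NFable (padd f g).
Proof.
move=> [nf wf fn] [ng wg gn]; exists (nf ++ ng); first by rewrite all_cat wf.
move=> R I x idI LI; rewrite ev_pnf big_cat -!ev_pnf ev_add opprD addrACA.
by apply: idealD => //; [apply: fn|apply: gn].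
Qed.

Lemma NFable_scale k f : NFable f -> NFable (pscale k f).
Proof.
move=> [nf wf fn]; exists [seq (k * t.1, t.2) | t <- nf].
  by rewrite all_map.
move=> R I x idI LI; rewrite ev_pnf big_map ev_scale.
under eq_bigr do rewrite -scalerA.
by rewrite -scaler_sumr -ev_pnf -scalerBr; apply: idealZ => //; apply: fn.
Qed.

(** One round of insertion sort, each swap changing the sign. The prefix is kept because pairing
    depends on the position; neither the outcome nor the sign depends on the algebra. *)
Lemma cm_insert pre a s : sorted ltn s -> ~~ odd (size (pre ++ a :: s)) ->
  (forall (R : algType K) (I : R -> Prop) x, is_ideal I -> lie_nilpotent I ->
     I (cm x (pre ++ a :: s))) \/
  exists k s', [/\ sorted ltn s', perm_eq s' (a :: s) &
    forall (R : algType K) (I : R -> Prop) x, is_ideal I -> lie_nilpotent I ->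
     I (cm x (pre ++ a :: s) - k *: cm x (pre ++ s'))].
Proof.
elim: s pre => [|b s IH] pre sbs ev_s.
  by right; exists 1, [:: a]; split=> // R I x idI _; rewrite scale1r subrr; apply: ideal0.
have [ab|ba|ab] := ltngtP a b.
- right; exists 1, [:: a, b & s]; split=> //=; first by rewrite ab.
  by move=> R I x idI _; rewrite scale1r subrr; apply: ideal0.
- have ev' : ~~ odd (size (rcons pre b ++ a :: s)).
    by move: ev_s; rewrite !size_cat size_rcons /= !addnS ?addSn.
  have [Z|[k [s' [ss' ps' H]]]] := IH (rcons pre b) (path_sorted sbs) ev'.
    left=> R I x idI LI; have := cm_swap idI LI x ev_s.
    by have := Z R I x idI LI; rewrite cat_rcons => Ib Is;
       have := idealB idI Is Ib; rewrite addrK.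
  right; exists (- k), (b :: s'); split=> //.
  - rewrite /= (path_sortedE ltn_trans) ss' andbT (perm_all _ ps') /= ba /=.
    by move: sbs; rewrite /= (path_sortedE ltn_trans) => /andP [].
  - by rewrite -(perm_cons b) in ps'; apply: perm_trans ps' _; apply/permPl/(perm_catCA [:: b] [:: a] s).
  move=> R I x idI LI; have Is := cm_swap idI LI x ev_s.
  have := H R I x idI LI; rewrite !cat_rcons => Ib.
  by have := idealB idI Is Ib; rewrite scaleNr opprK opprD opprK addrA addrK.
(* Swapping two equal letters gives z + z in [I], hence z in [I]. *)
- left=> R I x idI LI; apply: (ideal_half idI char2).
  by rewrite ab in ev_s *; apply: cm_swap.
Qed.

Lemma cm_sort pre s : ~~ odd (size (pre ++ s)) ->
  (forall (R : algType K) (I : R -> Prop) x, is_ideal I -> lie_nilpotent I ->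
     I (cm x (pre ++ s))) \/
  exists k s', [/\ sorted ltn s', perm_eq s' s &
    forall (R : algType K) (I : R -> Prop) x, is_ideal I -> lie_nilpotent I ->
     I (cm x (pre ++ s) - k *: cm x (pre ++ s'))].
Proof.
elim: s pre => [|a s IH] pre ev_s.
  by right; exists 1, [::]; split=> // R I x idI _; rewrite scale1r subrr; apply: ideal0.
have [|Z|[k [s' [ss' ps' H]]]] := IH (rcons pre a); rewrite ?cat_rcons //.
  by left => R I x idI LI; have := Z R I x idI LI; rewrite cat_rcons.
have ev' : ~~ odd (size (pre ++ a :: s')).
  by move: ev_s; rewrite !size_cat /= (perm_size ps').
have [Z|[l [s'' [ss'' ps'' H']]]] := cm_insert ss' ev'.
  left=> R I x idI LI; have := H R I x idI LI; rewrite !cat_rcons => Ib.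
  by have := idealD idI Ib (idealZ idI k (Z R I x idI LI)); rewrite subrK.
right; exists (k * l), s''; split=> //.
  by apply: perm_trans ps'' _; rewrite perm_cons.
move=> R I x idI LI; have := H R I x idI LI; rewrite !cat_rcons => Ib.
have := idealD idI Ib (idealZ idI k (H' R I x idI LI)).
by rewrite scalerBr scalerA addrA subrK.
Qed.

Lemma NFable_term u s : sorted leq u -> ~~ odd (size s) -> NFable (pterm u s).
Proof.
move=> su es; have [Z|[k [s' [ss' ps' H]]]] := @cm_sort [::] s es.
  exists [::] => // R I x idI LI; rewrite ev_zero subr0 ev_term.
  by apply: idealMl => //; apply: Z.
exists [:: (k, (u, s'))]; first by rewrite /= /nf_wf /= su ss' (perm_size ps') es.
move=> R I x idI LI; rewrite ev_pnf big_seq1 ev_term scalerAr -mulrBr.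
by apply: idealMl => //; apply: (H R I x).
Qed.

(** The letter k moves left past each larger letter l, at the cost of a commutator [l,k] that is
    central modulo [I] and joins [s]. *)
Lemma NFable_insert u k v s : sorted leq (u ++ v) -> all (leq k) v ->
  ~~ odd (size s) -> NFable (pmul (pword (u ++ k :: v)) (pcm s)).
Proof.
elim/last_ind: u v s => [|u l IH] v s suv kv es.
  by apply: NFable_term; rewrite //= (path_sortedE leq_trans) kv.
have [lk|kl] := leqP l k.
  apply: NFable_term => //; move: suv.
  rewrite !(sorted_pairwise leq_trans) !pairwise_cat pairwise_cons allrel_consr kv.
  rewrite !all_rcons lk => /and3P [-> pul ->]; rewrite pul !andbT /=.
  move: pul; rewrite pairwise_rcons => /andP [/allP ul _].
  by apply/allP => i /ul il; apply: leq_trans lk.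
rewrite cat_rcons in suv.
apply: (@NFable_eq _ (padd (pmul (pword (u ++ k :: l :: v)) (pcm s))
   (pmul (pmul (pword u) (pcomm (pvar K l) (pvar K k))) (pmul (pword v) (pcm s))))).
  move=> R x; rewrite ev_add !ev_mul !ev_word ev_comm !ev_var cat_rcons.
  by rewrite !mon_cat !mon_cons /comm mulrBr !mulrBl !mulrA [RHS]addrC subrK.
apply: NFable_add; first by apply: IH => //=; rewrite (ltnW kl).
apply: (@NFable_cong _ (pterm (u ++ v) [:: l, k & s])); last first.
  apply: NFable_term => //=; last by rewrite negbK.
  move: suv; apply: subseq_sorted; first exact: leq_trans.
  by rewrite cat_subseq // subseq_cons.
move=> R I x idI LI; rewrite ev_term !ev_mul ev_comm !ev_var !ev_word ev_cm /=.
rewrite mon_cat -!mulrA -mulrBr; apply: idealMl => //.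
rewrite !mulrA -mulrBl; apply: idealMr => //; exact: LI.
Qed.

Lemma NFable_mul_var f k : NFable f -> NFable (pmul f (pvar K k)).
Proof.
move=> [nf wf fn]; apply: (@NFable_cong _ (pmul (pnf nf) (pvar K k))).
  move=> R I x idI LI; rewrite !ev_mul -mulrBl; apply: idealMr => //; exact: fn.
elim: nf {f fn} wf => [_|[c [u s]] nf IH /= /andP [/and3P [/= su ss es] wf]].
  by apply: NFable_zero.
apply: (@NFable_eq _ (padd (pscale c (pmul (pterm u s) (pvar K k))) (pmul (pnf nf) (pvar K k)))).
  move=> R x; rewrite ev_add ev_scale !ev_mul.
  by rewrite [ev x (_ ++ _)]ev_add ev_scale mulrDl scalerAl ev_mul.
apply: NFable_add; last exact: IH.
apply: NFable_scale; apply: (@NFable_cong _ (pmul (pword (u ++ [:: k])) (pcm s))).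
  move=> R I x idI LI; rewrite !ev_mul ev_var !ev_word ev_cm mon_cat mon_cons mon_nil mulr1.
  rewrite -!mulrA -mulrBr; apply: idealMl => //.
  by rewrite -opprB; apply: idealN => //; apply: cm_central.
by apply: NFable_insert; rewrite ?cats0.
Qed.

Lemma NFable_all f : NFable f.
Proof.
elim: f => [|[c w] f IH]; first exact: NFable_zero.
apply: (@NFable_eq _ (padd (pscale c (pword w)) f)).
  move=> R x; rewrite -[_ :: f]/(padd [:: (c, w)] f) !ev_add ev_scale ev_word.
  by rewrite /ev lsum_word.
apply: NFable_add => //; apply: NFable_scale.
elim/last_ind: w => [|w k IHw].
  apply: (@NFable_eq _ (pterm [::] [::])); last exact: NFable_term.
  by move=> R x; rewrite ev_term ev_word mon_nil mulr1.
apply: NFable_eq (NFable_mul_var k IHw) => R x.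
by rewrite ev_mul ev_var !ev_word -cats1 mon_cat mon_cons mon_nil mulr1.
Qed.

End NormalForm.

Lemma map_index_iota (T : eqType) (s : seq T) :
  uniq s -> [seq index i s | i <- s] = iota 0 (size s).
Proof.
case: s => // x0 s us; apply: (@eq_from_nth _ 0%N) => [|i]; rewrite size_map.
  by rewrite size_iota.
by move=> il; rewrite (nth_map x0) // index_uniq // nth_iota.
Qed.

Lemma cm_prod (K : fieldType) (R : algType K) (x : nat -> R) q s :
  (q.*2 <= size s)%N ->
  exists2 l : seq (R * R), size l = q &
    exists s', cm x s = (\prod_(p <- l) comm p.1 p.2) * cm x s'.
Proof.
elim/seq2_ind: s q => [|a|a b s IH] [|q] // sq.
- by exists [::] => //; exists [::]; rewrite big_nil mul1r.
- by exists [::] => //; exists [:: a]; rewrite big_nil mul1r.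
- by exists [::] => //; exists [:: a, b & s]; rewrite big_nil mul1r.
have [l sl [s' e]] := IH q sq.
by exists ((x a, x b) :: l); [rewrite /= sl|exists s'; rewrite big_cons /= e mulrA].
Qed.

(** * Identities of the Grassmann algebra on finitely many generators *)

Section GrassmannIdentities.
Variables (K : fieldType) (charK0 : [pchar K] =i pred0) (n : nat).
Local Notation G := (grass K n).

Let char2 : 2%:R != 0 :> K. Proof. by rewrite (pcharf0P K).1. Qed.

(** Commutators see only the odd part, so this point kills commutator products with a letter outside
    [s], while the scalars separate the ordered monomials. *)
Definition gpoint (s : seq nat) (r : nat -> K) (i : nat) : G :=
  r i *: 1 + (if i \in s then ge K n (index i s) else 0).

Lemma zero_ideal : is_ideal (fun z : G => z = 0).
Proof.
split=> // [a b -> ->|k a ->|a b ->|a b ->]; first exact: addr0.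
- exact: scaler0.
- exact: mulr0.
- exact: mul0r.
Qed.

Lemma comm_scalar (k : K) (y : G) : comm (k *: 1) y = 0.
Proof. by rewrite /comm -scalerAl -scalerAr mul1r mulr1 subrr. Qed.

Lemma cm_scalar (x : nat -> G) s i k : ~~ odd (size s) -> i \in s -> x i = k *: 1 ->
  cm x s = 0.
Proof.
move=> es si xi; elim/seq2_ind: s es si => [//|a //|a b s IH] /=.
rewrite negbK !inE => es /or3P [/eqP <-|/eqP <-|si].
- by rewrite xi comm_scalar mul0r.
- by rewrite xi commC comm_scalar oppr0 mul0r.
- by rewrite IH // mulr0.
Qed.

Lemma cm_point (x h : nat -> G) (r : nat -> K) s :
  (forall i, godd (h i)) -> (forall i, i \in s -> x i = r i *: 1 + h i) ->
  ~~ odd (size s) -> cm x s = 2%:R ^+ (size s)./2 *: mon h s.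
Proof.
move=> ho; elim/seq2_ind: s => [_ _|a //|a b s IH] /=.
  by rewrite mon_nil scale1r.
rewrite negbK => xs es; rewrite IH //; last first.
  by move=> i si; apply: xs; rewrite !inE si !orbT.
rewrite xs ?inE ?eqxx // [x b]xs ?inE ?eqxx ?orbT //.
rewrite comm_even_shift; try by apply/evenZ/even1.
rewrite !mon_cons /comm -(odd_anticomm (ho a) (ho b)) -mulr2n -scaler_nat.
by rewrite -scalerAl -scalerAr scalerA -exprS mulrA.
Qed.

(** Every odd generator occurring in [gpoint] is a factor of [E] and is killed by it; only the
    scalars survive. *)
Lemma mon_point s r u : uniq s ->
  let E := mon (fun i => ge K n (index i s)) s in
  mon (gpoint s r) u * E = (\prod_(i <- u) r i) *: E.
Proof.
move=> us /=; set h := fun i => _; elim: u => [|i u IH].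
  by rewrite mon_nil big_nil mul1r scale1r.
rewrite mon_cons big_cons -mulrA IH -scalerAr /gpoint mulrDl -scalerAl mul1r.
case: ifP => [si|_].
  rewrite [ge _ _ _ * _](@mon_odd_mem K char2 n h) ?addr0 ?scalerA 1?mulrC //.
  by move=> j; apply: ge_odd.
by rewrite mul0r addr0 scalerA mulrC.
Qed.

Lemma mon_index_neq0 s : uniq s -> (size s <= n)%N ->
  mon (fun i => ge K n (index i s)) s != 0.
Proof.
move=> us sn; have -> : mon (fun i => ge K n (index i s)) s =
    mon (@ge K n) (iota 0 (size s)).
  by rewrite -map_index_iota // /mon big_map.
rewrite mon_ge iota_uniq /= ifT; last first.
  by apply/allP => i; rewrite mem_iota => /andP [_ /leq_trans]; apply.
rewrite scaler_eq0 signr_eq0 /=; apply/eqP => /ffunP /(_ (wset n (iota 0 (size s)))).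
by rewrite !ffunE eqxx => /eqP; rewrite oner_eq0.
Qed.

(** Induction on the number of commutator letters. At [gpoint s0 alpha] the terms with fewer letters
    cancel by induction, and all others with s different from s0 contain a scalar letter. What
    remains is a polynomial in alpha times 2^q E, where E is nonzero because s0 has at most n
    letters. *)
Lemma nf_coef0 (nf : nform K) : all (@nf_wf K) nf ->
  (forall s r, sorted ltn s -> ~~ odd (size s) -> (size s <= n)%N ->
     ev (gpoint s r) (pnf nf) = 0) ->
  forall k : seq nat * seq nat, (size k.2 <= n)%N ->
  \sum_(t <- nf | t.2 == k) t.1 = 0.
Proof.
move=> /allP wf ez.
suff H d (k : seq nat * seq nat) : (size k.2 < d)%N -> (size k.2 <= n)%N ->
    \sum_(t <- nf | t.2 == k) t.1 = 0.
  by move=> k; apply: (H (size k.2).+1).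
elim: d k => [|d IH] k; first by rewrite ltn0.
case: k => u0 s0 /= kd kn.
have [/and3P [/= su ss es]|nwf] := boolP (@nf_wf K (1, (u0, s0))); last first.
  rewrite big1_seq // => t /andP [/eqP et /wf wt].
  by case/negP: nwf; rewrite /nf_wf -et.
have us : uniq s0 by apply: sorted_uniq ss; [exact: ltn_trans|exact: ltnn].
pose f := [seq (t.1, t.2.1) | t <- nf & t.2.2 == s0] : ncpoly K.
have fz alpha : \sum_(t <- f) t.1 * \prod_(i <- t.2) alpha i = 0.
  have := ez s0 alpha ss es kn; rewrite ev_pnf.
  rewrite (bigID (fun t => size t.2.2 < size s0)%N) /=.
  rewrite (@key_sum0 K _ _ (fun k => mon (gpoint s0 alpha) k.1 * cm (gpoint s0 alpha) k.2)
     nf (fun k => size k.2 < size s0)%N) => [|k kl]; last first.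
    by apply: IH; [exact: leq_trans kl kd|exact: leq_trans (ltnW kl) kn].
  rewrite add0r => e.
  set E := mon (fun i => ge K n (index i s0)) s0.
  have cE : cm (gpoint s0 alpha) s0 = 2%:R ^+ (size s0)./2 *: E.
    apply: (@cm_point _ _ alpha) => // [i|i si]; first exact: ge_odd.
    by rewrite /gpoint si.
  suff : (\sum_(t <- f) t.1 * \prod_(i <- t.2) alpha i) *: (2%:R ^+ (size s0)./2 *: E) = 0.
    move/eqP; rewrite !scaler_eq0 expf_eq0 (negPf char2) andbF /=.
    by rewrite (negPf (mon_index_neq0 us kn)) orbF => /eqP.
  rewrite -{}e /f big_map big_filter scaler_suml big_mkcond [RHS]big_mkcond.
  rewrite big_seq [RHS]big_seq; apply: eq_bigr => -[c [u s]] /wf /= /and3P [/= _ ss' es'].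
  have [->|ns] := eqVneq s s0.
    rewrite ltnn /= cE -scalerAr mon_point // -scalerA; congr (_ *: _).
    by rewrite !scalerA mulrC.
  case: ifP => //; rewrite -leqNgt => sl.
  have us' : uniq s by apply: sorted_uniq ss'; [exact: ltn_trans|exact: ltnn].
  (* Strictly increasing lists with s inside s0 and s at least as long would be equal. *)
  have [i si nsi] : exists2 i, i \in s & i \notin s0.
    apply/allPn; apply: contra ns => /allP sub.
    have [e1 e2] := uniq_min_size us' sub sl.
    apply/eqP/(@irr_sorted_eq _ ltn) => //; [exact: ltn_trans|exact: ltnn].
  rewrite (@cm_scalar _ _ i (alpha i)) ?mulr0 ?scaler0 //.
  by rewrite /gpoint (negPf nsi) addr0.
have := monomial_coef_eq0 charK0 fz u0; rewrite /f big_map big_filter_cond => e.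
rewrite -[RHS]e big_seq_cond [RHS]big_seq_cond; apply: eq_bigl => -[c [u s]] /=.
apply: andb_id2l => /wf /and3P [/= su' _ _]; rewrite xpair_eqE andbC.
congr (_ && _); apply/eqP/idP => [->//|].
exact: (sorted_eq leq_trans anti_leq su' su).
Qed.

End GrassmannIdentities.

Lemma grassmann_identities (K : fieldType) (charK0 : [pchar K] =i pred0) m
    (R : algType K) (I : R -> Prop) (g : ncpoly K) :
  is_ideal I -> lie_nilpotent I ->
  (forall l : seq (R * R), size l = m.+1 -> I (\prod_(p <- l) comm p.1 p.2)) ->
  (forall s r, sorted ltn s -> ~~ odd (size s) -> (size s <= m.*2)%N ->
     ev (@gpoint K m.*2 s r) g = 0) ->
  forall x, I (ev x g).
Proof.
move=> idI LI PI gz x.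
have char2 : 2%:R != 0 :> K by rewrite (pcharf0P K).1.
have [nf wf gn] := NFable_all char2 g.
rewrite -(subrK (ev x (pnf nf)) (ev x g)); apply: idealD => //; first exact: gn.
have nz : forall k : seq nat * seq nat, (size k.2 <= m.*2)%N -> \sum_(t <- nf | t.2 == k) t.1 = 0.
  apply: (nf_coef0 charK0 wf) => s r ss es sn.
  (* Commutators are central in the Grassmann algebra, so with the zero ideal the normal form agrees
     with [g] at these points. *)
  have := gn _ _ (gpoint m.*2 s r) (@zero_ideal K m.*2) (@comm_comm_grass K m.*2).
  by rewrite gz // sub0r => /eqP; rewrite oppr_eq0 => /eqP.
rewrite ev_pnf (bigID (fun t => size t.2.2 <= m.*2)%N) /=.
rewrite (@key_sum0 K _ _ (fun k => mon x k.1 * cm x k.2) nf (fun k => size k.2 <= m.*2)%N) //.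
rewrite add0r big_seq_cond; apply: ideal_sum => // -[c [u s]] /=.
rewrite -ltnNge => /andP [/(allP wf) /and3P [/= _ _ es] sm].
(* The remaining s have even length above 2m, hence at least m + 1 commutators. *)
have [|l sl [s' ->]] := @cm_prod K R x m.+1 s.
  rewrite doubleS; move: sm; rewrite leq_eqVlt => /orP [/eqP e|//].
  by move: es; rewrite -e /= odd_double.
by apply: idealZ => //; apply: idealMl => //; apply: idealMr => //; apply: PI.
Qed.

(** * The free algebra and its T-ideals *)

Section FreeAlgebra.
Variable K : fieldType.
Import monalg.

(** Finitely supported functions on the free monoid: a genuine algebra in which ideals and
    evaluations make sense. *)
Definition freealg := {malg K[{fmonom nat}]}.
HB.instance Definition _ := GRing.Lalgebra.copy freealg {malg K[{fmonom nat}]}.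

Lemma freealg_scaleAr (k : K) (x y : freealg) : k *: (x * y) = x * (k *: y).
Proof.
apply/malgP => u; rewrite mcoeffZ.
rewrite (@mcoeffMlw _ _ (msupp x) (msupp y)) ?finmap.fsubset_refl //.
rewrite (@mcoeffMlw _ _ (msupp x) (msupp y)) ?finmap.fsubset_refl ?msuppZ_le //.
rewrite mulr_sumr; apply: eq_bigr => v _; rewrite mulr_sumr; apply: eq_bigr => w _.
by rewrite mcoeffZ mulrnAr mulrCA.
Qed.
HB.instance Definition _ := GRing.Lalgebra_isAlgebra.Build K freealg freealg_scaleAr.

Definition fvar (i : nat) : freealg := << fmu i >>.
Definition to_ncpoly (y : freealg) : ncpoly K :=
  [seq (y@_u, fmonom_val u) | u <- finmap.enum_fset (msupp y)].

Lemma mon_fvar w : mon fvar w = << FMonom w >> :> {malg K[{fmonom nat}]}.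
Proof.
elim: w => [|i w IH]; first by rewrite mon_nil -fmoneE.
rewrite mon_cons IH /fvar [LHS]malgM_def fgmulUU mulr1.
by rewrite [mmul _ _]fmmulE fmuE.
Qed.

Lemma ev_to_ncpoly y : ev fvar (to_ncpoly y) = y.
Proof.
rewrite /ev /lsum big_map [RHS]monalgE; apply: eq_bigr => u _ /=.
rewrite mon_fvar fmK; apply/malgP => v; rewrite mcoeffZ !mcoeffU.
by rewrite mulr_natr.
Qed.

Lemma ev_fvar_coef (f : ncpoly K) w : (ev fvar f : {malg K[_]})@_(FMonom w) = pcoef f w.
Proof.
rewrite /ev /lsum /pcoef raddf_sum /= big_mkcond [RHS]big_mkcond; apply: eq_bigr => t _.
by rewrite mon_fvar mcoeffZ mcoeffU1 fmP /=; case: eqP; rewrite ?mulr1 ?mulr0.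
Qed.

Lemma ev_fvar_inj (f g : ncpoly K) : ev fvar f = ev fvar g -> peq f g.
Proof. by move=> e w; rewrite -!ev_fvar_coef e. Qed.

End FreeAlgebra.

Section TIdeal.
Variables (K : fieldType) (S : ncpoly K -> Prop).
Local Notation F := (freealg K).
Local Notation x := (@fvar K).
Implicit Types y z : F.

Lemma T_ideal_gen_T_ideal : is_T_ideal (T_ideal_gen S).
Proof.
split=> [f g fg Jf I TI SI|].
  by have [Ieq _] := TI; apply: (Ieq f) => //; apply: Jf.
split=> [I TI SI|]; first by have [_ [? _]] := TI.
split=> [f g Jf Jg I TI SI|].
  by have [_ [_ [Iadd _]]] := TI; apply: Iadd; [apply: Jf|apply: Jg].
split=> [c f Jf I TI SI|].
  by have [_ [_ [_ [Isc _]]]] := TI; apply: Isc; apply: Jf.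
split=> [f g Jf|sigma f Jf I TI SI].
  by split=> I TI SI; have [_ [_ [_ [_ [Imul _]]]]] := TI; have [] := Imul f g (Jf I TI SI).
by have [_ [_ [_ [_ [_ Isub]]]]] := TI; apply: Isub; apply: Jf.
Qed.

Definition Tgen y := T_ideal_gen S (to_ncpoly y).

Lemma TgenE f : Tgen (ev x f) <-> T_ideal_gen S f.
Proof.
have [Jeq _] := T_ideal_gen_T_ideal.
by split; apply: Jeq; apply: ev_fvar_inj; rewrite ev_to_ncpoly.
Qed.

Lemma Tgen_ideal : is_ideal Tgen.
Proof.
have [_ [J0 [JD [JZ [JM _]]]]] := T_ideal_gen_T_ideal; split.
- by rewrite -(ev_zero x); apply/TgenE.
- move=> y z Jy Jz; rewrite -(ev_to_ncpoly y) -(ev_to_ncpoly z) -ev_add.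
  by apply/TgenE; apply: JD.
- by move=> k y Jy; rewrite -(ev_to_ncpoly y) -ev_scale; apply/TgenE; apply: JZ.
- move=> y z Jz; rewrite -(ev_to_ncpoly y) -(ev_to_ncpoly z) -ev_mul.
  by apply/TgenE; apply: (JM _ _ _).1.
- move=> y z Jz; rewrite -(ev_to_ncpoly y) -(ev_to_ncpoly z) -ev_mul.
  by apply/TgenE; apply: (JM _ _ _).2.
Qed.

(** Evaluating a generator at arbitrary elements of the free algebra is a substitution, under which
    the T-ideal is closed. *)
Lemma Tgen_subst (f : ncpoly K) (y : nat -> F) : S f -> Tgen (ev y f).
Proof.
have [_ [_ [_ [_ [_ JS]]]]] := T_ideal_gen_T_ideal.
move=> Sf; rewrite (_ : ev y f = ev x (psubst (fun i => to_ncpoly (y i)) f)).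
  by apply/TgenE; apply: JS => I TI SI; apply: SI.
by rewrite ev_subst; apply: eq_ev => i; rewrite ev_to_ncpoly.
Qed.

End TIdeal.

(** * The T-ideal J and the ideal of all y with C y inside J *)

Section TwoGenerators.
Variables (K : fieldType) (n : nat).
Local Notation F := (freealg K).
Local Notation J := (@Tgen K (fun g => g = @gen1 K \/ g = @gen2 K n)).

Lemma J_gen1 (p q a b c : F) : J (comm p q * comm (comm a b) c).
Proof.
have := @Tgen_subst K (fun g => g = @gen1 K \/ g = @gen2 K n) (gen1 K)
  (nth 0 [:: p; q; a; b; c]) (or_introl (erefl _)).
rewrite /gen1 -[pcommn _ _]/(pcomm (pcomm (pvar K 2) (pvar K 3)) (pvar K 4)).
by rewrite ev_mul !ev_comm !ev_var.
Qed.

Lemma J_gen2 (l : seq (F * F)) : size l = n./2.+2 -> J (\prod_(p <- l) comm p.1 p.2).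
Proof.
(* The variables 2i and 2i + 1 receive the two members of the i-th pair. *)
move=> sl; pose y i := let p := nth (0, 0) l i./2 in if odd i then p.2 else p.1.
have := @Tgen_subst K (fun g => g = @gen1 K \/ g = @gen2 K n) (gen2 K n)
  y (or_intror (erefl _)).
rewrite /gen2 /comm_prod -/(commprod_from K _) ev_commprod addn2 -sl.
suff -> : \prod_(i <- iota 0 (size l)) comm (y i.*2) (y i.*2.+1) =
  \prod_(p <- l) comm p.1 p.2 by [].
rewrite -[RHS](congr1 (fun l => \prod_(p <- l) comm p.1 p.2) (mkseq_nth (0, 0) l)).
rewrite big_map; apply: eq_bigr => i _; rewrite /y /= odd_double /= doubleK.
by rewrite uphalf_double.
Qed.

(* The y with C y inside J, where C is the commutator ideal. *)
Definition Jres (y : F) := forall p q v : F, J (comm p q * v * y).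

Lemma Jres_ideal : is_ideal Jres.
Proof.
have idJ := Tgen_ideal (fun g => g = @gen1 K \/ g = @gen2 K n).
split=> [p q v|y z Jy Jz p q v|k y Jy p q v|y z Jz p q v|y z Jy p q v].
- by rewrite mulr0; apply: (ideal0 idJ).
- by rewrite mulrDr; apply: (idealD idJ); [apply: Jy|apply: Jz].
- by rewrite -scalerAr; apply: (idealZ idJ); apply: Jy.
- by rewrite mulrA -[_ * v * y]mulrA; apply: Jz.
- by rewrite mulrA; apply: (idealMr idJ); apply: Jy.
Qed.

(** The middle factor is absorbed by [p,q]v = [p,qv] - q[p,v]. *)
Lemma Jres_intro y : (forall p q, J (comm p q * y)) -> Jres y.
Proof.
have idJ := Tgen_ideal (fun g => g = @gen1 K \/ g = @gen2 K n).
move=> H p q v; have -> : comm p q * v = comm p (q * v) - q * comm p v.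
  by rewrite comm_mulr addrC addrA addNr add0r.
by rewrite mulrBl -mulrA; apply: (idealB idJ); [apply: H|apply: (idealMl idJ)].
Qed.

Lemma Jres_lie : lie_nilpotent Jres.
Proof. by move=> a b c; apply: Jres_intro => p q; apply: J_gen1. Qed.

Lemma Jres_prod (l : seq (F * F)) : size l = n./2.+1 ->
  Jres (\prod_(p <- l) comm p.1 p.2).
Proof.
move=> sl; apply: Jres_intro => p q.
by have := @J_gen2 ((p, q) :: l); rewrite /= sl big_cons; apply.
Qed.

(** The difference of the two words lies in C: pulling the first letter a of [w] to the front of w'
    = p a q costs [a,p] q, and induction handles the rest. *)
Lemma J_perm (w w' : seq nat) y : Jres y -> perm_eq w w' ->
  J ((mon (@fvar K) w - mon (@fvar K) w') * y).
Proof.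
have idJ := Tgen_ideal (fun g => g = @gen1 K \/ g = @gen2 K n).
move=> Jy; elim: w w' => [|a w IH] w' pw.
  by rewrite perm_sym in pw; rewrite (perm_nilP pw) subrr mul0r; apply: (ideal0 idJ).
have : a \in w' by rewrite -(perm_mem pw) mem_head.
move=> aw'; case: (path.splitPr aw') pw => p q pw {aw'}.
have pw' : perm_eq w (p ++ q).
  by rewrite -(perm_cons a); apply: (perm_trans pw); rewrite -cat1s perm_catCA.
have -> : mon (@fvar K) (a :: w) - mon (@fvar K) (p ++ a :: q) =
   fvar K a * (mon (@fvar K) w - mon (@fvar K) (p ++ q)) +
   comm (fvar K a) (mon (@fvar K) p) * mon (@fvar K) q.
  by rewrite !mon_cat !mon_cons mulrBr /comm mulrBl !mulrA addrA subrK.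
rewrite mulrDl; apply: (idealD idJ); last exact: Jy.
by rewrite -mulrA; apply: (idealMl idJ); exact: (IH _ pw').
Qed.

End TwoGenerators.

(** * Evaluation points of F_n(A) *)

Section Points.
Variables (K : fieldType) (charK0 : [pchar K] =i pred0) (n : nat) (n_gt1 : (1 < n)%N).
Variables (s : seq nat) (sn : (size s <= n)%N) (r alpha : nat -> K) (j : nat).
Local Notation G := (grass K n).

(** Apart from the scalar 1 at variable 0, all Grassmann generators sit in the lower right corner;
    variable 1 also carries the matrix unit e_12, whence the need for n > 1. *)
Definition apoint (k : nat) : Amat K :=
  (pzero K, if k == 1%N then pone K else pzero K,
   if k == 0%N then padd (pone K) (pvar K 0) else pvar K k).

Let a (k : nat) : G := 0.
Let b (k : nat) : G := (k == 1%N)%:R.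
Let c (k : nat) : G := (k == 0%N)%:R + ge K n k.

Lemma apoint_gtrunc k : [/\ gtrunc n (apoint k).1.1 = a k,
  gtrunc n (apoint k).1.2 = b k & gtrunc n (apoint k).2 = c k].
Proof.
split; first exact: gtrunc_zero.
  rewrite -[(apoint k).1.2]/(if k == 1%N then pone K else pzero K) /b.
  by case: ifP; rewrite ?gtrunc_one ?gtrunc_zero.
rewrite -[(apoint k).2]/(if k == 0%N then padd (pone K) (pvar K 0) else pvar K k) /c.
case: eqP => [->|_]; rewrite /gtrunc ?ev_add ?ev_one ev_var //.
by rewrite add0r.
Qed.

(* x_0 -> diag(0, 1 + e_0), so that x_0 (2 - x_0) -> e_22. *)
Definition pe22 : ncpoly K :=
  pmul (pvar K 0) (padd (pscale 2%:R (pone K)) (pscale (-1) (pvar K 0))).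
(** Variable 1 has value e_12 + e_1 e_22, and left multiplication by e_22 isolates the second
    term. *)
Definition pe12 : ncpoly K :=
  padd (pvar K 1) (pscale (-1) (pmul pe22 (pvar K 1))).
(** Used only after the factor [pe22], which removes the unwanted upper left entry -1 for k = 0. *)
Definition pgen k : ncpoly K :=
  if k == 0%N then padd (pvar K 0) (pscale (-1) (pone K)) else pvar K k.
(** The scalar matrix alpha_i, corrected by e_22 so that the lower right entry becomes [gpoint],
    plus e_12 for the single variable j. *)
Definition spoint i : ncpoly K :=
  padd (pscale (alpha i) (pone K))
    (padd (pmul pe22 (padd (pscale (r i - alpha i) (pone K))
                           (if i \in s then pgen (index i s) else pzero K)))
          (if i == j then pe12 else pzero K)).

Lemma in_vars_spoint i : in_vars n (spoint i).
Proof.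
have v0 : in_vars n (pvar K 0) by apply: in_vars_var; apply: ltnW.
have v1 : in_vars n (pvar K 1) by apply: in_vars_var.
have vone := @in_vars_one K n.
have v22 : in_vars n pe22.
  by apply: in_vars_mul => //; apply: in_vars_cat; apply: in_vars_scale.
apply: in_vars_cat; first exact: in_vars_scale.
apply: in_vars_cat.
  apply: in_vars_mul => //; apply: in_vars_cat; first exact: in_vars_scale.
  case: ifP => // si; rewrite /pgen; case: ifP => _.
    by apply: in_vars_cat => //; apply: in_vars_scale.
  by apply: in_vars_var; apply: leq_trans sn; rewrite index_mem.
case: ifP => // _; apply: in_vars_cat => //; apply: in_vars_scale.
exact: in_vars_mul.
Qed.

Let char2 : 2%:R != 0 :> K. Proof. by rewrite (pcharf0P K).1. Qed.

Lemma ev_a_e22 : ev a pe22 = 0.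
Proof. by rewrite ev_mul ev_var mul0r. Qed.

Lemma ev_c_e22 : ev c pe22 = 1.
Proof.
rewrite ev_mul ev_add !ev_scale ev_one ev_var scaleN1r /c /=.
rewrite scaler_nat mulr2n opprD addrA addrK.
rewrite mulrBr mulr1 mulrDl mul1r (odd_sq char2) ?addr0 ?addrK //.
exact: ge_odd.
Qed.

Lemma dev_e22 : dev a b c pe22 = 0.
Proof. by rewrite dev_mul ev_var dev_var !mul0r addr0. Qed.

Lemma ev_a_point i : ev a (spoint i) = alpha i *: 1.
Proof.
rewrite !ev_add ev_scale ev_one ev_mul ev_a_e22 mul0r add0r.
case: ifP => _; last by rewrite ev_zero addr0.
by rewrite ev_add ev_scale ev_mul ev_a_e22 mul0r scaler0 ev_var !addr0.
Qed.

Lemma ev_c_point i : ev c (spoint i) = gpoint n s r i.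
Proof.
rewrite !ev_add ev_scale ev_one ev_mul ev_c_e22 mul1r ev_add ev_scale ev_one.
have -> : ev c (if i == j then pe12 else pzero K) = 0.
  case: ifP => _; last by rewrite ev_zero.
  by rewrite ev_add ev_scale ev_mul ev_c_e22 mul1r scaleN1r subrr.
rewrite addr0 addrA -scalerDl [alpha i + _]addrC subrK /gpoint; congr (_ + _).
case: ifP => _; last by rewrite ev_zero.
rewrite /pgen; case: eqP => [->|/eqP/negPf k0].
  by rewrite ev_add ev_scale ev_one ev_var scaleN1r /c eqxx addrC addKr.
by rewrite ev_var /c k0 add0r.
Qed.

Lemma dev_point i : dev a b c (spoint i) = (i == j)%:R.
Proof.
rewrite !dev_add dev_scale dev_one scaler0 add0r dev_mul ev_a_e22 dev_e22.
rewrite !mul0r addr0 add0r; case: ifP => _; last by rewrite dev_zero.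
rewrite dev_add dev_scale dev_mul ev_a_e22 dev_e22 !mul0r addr0 scaler0 addr0.
by rewrite dev_var.
Qed.

Lemma T_Fn_point f : T_Fn n f ->
  ev (fun i => alpha i *: 1 : G) f = 0 /\
  dev (fun i => alpha i *: 1 : G) (fun i => (i == j)%:R) (gpoint n s r) f = 0.
Proof.
move=> /(_ _ in_vars_spoint) /T_AP /(_ apoint) H.
have [|Ha Hb _] := H _ n; first by move=> i S _ _; rewrite /ecoef big_nil.
have ea k : gtrunc n (apoint k).1.1 = a k by have [] := apoint_gtrunc k.
have eb k : gtrunc n (apoint k).1.2 = b k by have [] := apoint_gtrunc k.
have ec k : gtrunc n (apoint k).2 = c k by have [] := apoint_gtrunc k.
split.
  rewrite -[RHS]Ha (eq_ev _ ea) ev_subst; apply: eq_ev => i.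
  by rewrite ev_a_point.
rewrite -[RHS]Hb (eq_dev _ ea eb ec) dev_subst; apply: eq_dev => i.
- by rewrite ev_a_point.
- by rewrite dev_point.
- by rewrite ev_c_point.
Qed.

End Points.

Lemma sort_eq_perm (u v : seq nat) : (sort leq u == sort leq v) = perm_eq u v.
Proof.
apply/eqP/idP => [e|/(perm_sortP leq_total leq_trans anti_leq) //].
by rewrite -(perm_sort leq u) e perm_sort.
Qed.

(** * The Schreier decomposition with respect to sorted words *)

Section Schreier.
Variable K : fieldType.

(** The word is read letter by letter with a sorted state t: replacing t x_k by its sorted form
    costs b_(t,k) times the unread rest. [mon_schreier] telescopes these steps. *)
Fixpoint schreier (t w : seq nat) : seq ((seq nat * nat) * seq nat) :=
  if w is k :: w' then ((t, k), w') :: schreier (sort leq (rcons t k)) w' else [::].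

Definition schreier_gen (key : seq nat * nat) : ncpoly K :=
  padd (pword K (rcons key.1 key.2))
       (pscale (-1) (pword K (sort leq (rcons key.1 key.2)))).

Definition schreier_all (f : ncpoly K) : seq (K * ((seq nat * nat) * seq nat)) :=
  flatten [seq [seq (t.1, e) | e <- schreier [::] t.2] | t <- f].

Definition schreier_keys f := undup [seq e.2.1 | e <- schreier_all f].
Definition schreier_coef f key : ncpoly K :=
  [seq (e.1, e.2.2) | e <- schreier_all f & e.2.1 == key].

Lemma ev_schreier_gen (R : algType K) (x : nat -> R) key :
  ev x (schreier_gen key) =
  mon x (rcons key.1 key.2) - mon x (sort leq (rcons key.1 key.2)).
Proof. by rewrite ev_add ev_scale !ev_word scaleN1r. Qed.

Lemma mon_schreier (R : algType K) (x : nat -> R) t w : sorted leq t ->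
  mon x (t ++ w) = mon x (sort leq (t ++ w)) +
    \sum_(e <- schreier t w) ev x (schreier_gen e.1) * mon x e.2.
Proof.
elim: w t => [|k w IH] t st.
  by rewrite cats0 big_nil addr0 sorted_sort //; apply: leq_trans.
rewrite big_cons /= ev_schreier_gen /= -cat_rcons mon_cat mulrBl.
have := IH _ (sort_sorted leq_total (rcons t k)); rewrite mon_cat => ->.
have -> : sort leq (sort leq (rcons t k) ++ w) = sort leq (rcons t k ++ w).
  by apply/eqP; rewrite sort_eq_perm perm_cat2r perm_sort.
by rewrite opprD !addrA subrK addrAC subrr add0r.
Qed.

Lemma schreier_sorted t w e : sorted leq t -> e \in schreier t w -> sorted leq e.1.1.
Proof.
elim: w t => // k w IH t st; rewrite /= inE => /orP [/eqP -> //|].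
by apply: IH; apply: sort_sorted; apply: leq_total.
Qed.

Lemma schreier_keys_sorted f key : key \in schreier_keys f -> sorted leq key.1.
Proof.
rewrite mem_undup => /mapP [e /flattenP [l /mapP [t _ ->] /mapP [e' e's ->]] ->] /=.
exact: schreier_sorted e's.
Qed.

Definition schreier_sum f : ncpoly K :=
  flatten [seq pmul (schreier_gen key) (schreier_coef f key) | key <- schreier_keys f].

Lemma ev_schreier_all (R : algType K) (x : nat -> R) f :
  \sum_(t <- f) t.1 *: mon x (sort leq t.2) = 0 ->
  ev x f = \sum_(key <- schreier_keys f)
     ev x (schreier_gen key) * ev x (schreier_coef f key).
Proof.
move=> z; rewrite /ev /lsum.
under eq_bigr => t _.
  rewrite -[t.2]cat0s (mon_schreier x t.2 (isT : sorted leq [::])) scalerDr.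
  over.
rewrite big_split /= z add0r.
transitivity (\sum_(e <- schreier_all f) e.1 *: (ev x (schreier_gen e.2.1) * mon x e.2.2)).
  rewrite big_flatten big_map; apply: eq_bigr => t _.
  by rewrite big_map scaler_sumr.
under [RHS]eq_bigr => key _.
  rewrite /schreier_coef big_map big_filter mulr_sumr.
  over.
rewrite (exchange_big_dep predT) //= big_seq [RHS]big_seq; apply: eq_bigr => e es.
rewrite (eq_bigl (pred1 e.2.1)) => [|k]; last by rewrite /= eq_sym.
rewrite -big_filter filter_pred1_uniq ?undup_uniq //; first by rewrite big_seq1 scalerAr.
by rewrite mem_undup; apply: (map_f (fun e : K * ((seq nat * nat) * seq nat) => e.2.1)).
Qed.

(** All factorisations w = u j v, recorded as (u, v); each contributes alpha^u times the value of v
    to the (1,2) entry of w. *)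
Fixpoint splits (j : nat) (w : seq nat) : seq (seq nat * seq nat) :=
  if w is i :: w' then
    (if i == j then [:: ([::], w')] else [::]) ++
    [seq (i :: e.1, e.2) | e <- splits j w']
  else [::].

Lemma splits_size j w e : e \in splits j w -> (size e.1 < size w)%N.
Proof.
elim: w e => // i w IH e /=; rewrite mem_cat => /orP [|/mapP [e' /IH se ->]] //.
by case: ifP => // _; rewrite inE => /eqP ->.
Qed.

Lemma splits_rcons j w k : splits j (rcons w k) =
  [seq (e.1, rcons e.2 k) | e <- splits j w] ++
  (if k == j then [:: (w, [::])] else [::]).
Proof.
elim: w => [|i w IH] /=; first by case: ifP.
rewrite IH map_cat !map_cat -!map_comp catA; congr (_ ++ _); last by case: ifP.
by congr (_ ++ _); case: ifP.
Qed.

Section SplitCoefficients.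
Variables (R : algType K) (x : nat -> R).

Lemma dmon_splits (alpha : nat -> K) j w :
  dmon (fun i => alpha i *: 1) (fun i => (i == j)%:R) x w =
  \sum_(e <- splits j w) (\prod_(i <- e.1) alpha i) *: mon x e.2.
Proof.
elim: w => [|i w IH] /=; first by rewrite big_nil.
rewrite big_cat big_map IH -scalerAl mul1r addrC; congr (_ + _).
  case: eqP => _; rewrite ?mul0r ?big_nil // big_seq1 big_nil mul1r scale1r //.
rewrite scaler_sumr; apply: eq_bigr => e _.
by rewrite big_cons scalerA.
Qed.

(** The coefficient of the commutative monomial alpha^u in [dmon_splits], hence the test up to
    permutation. *)
Definition split_coef j u w : R := \sum_(e <- splits j w | perm_eq e.1 u) mon x e.2.

Lemma split_coef_rcons j u w k : size u = size w ->
  split_coef j u (rcons w k) = ((k == j) && perm_eq w u)%:R.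
Proof.
move=> su; rewrite /split_coef splits_rcons big_cat big_map /= big_seq_cond big1 => [|e].
  rewrite add0r; case: ifP => _; last by rewrite big_nil.
  by rewrite big_mkcond big_seq1 /= mon_nil; case: ifP.
case/andP=> /splits_size se /perm_size eu; by rewrite -su -eu ltnn in se.
Qed.

Lemma split_coef_short j u w : (size w <= size u)%N -> split_coef j u w = 0.
Proof.
move=> su; rewrite /split_coef big_seq_cond big1 // => e /andP [/splits_size se /perm_size eu].
by move: (leq_trans se su); rewrite eu ltnn.
Qed.

(* The coefficient of alpha^u in the (1,2) entry of schreier_gen key. *)
Definition gen_coef j u (key : seq nat * nat) : R :=
  split_coef j u (rcons key.1 key.2) - split_coef j u (sort leq (rcons key.1 key.2)).

(* schreier_gen vanishes on the other keys, which [schreier] also lists. *)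
Definition descent (key : seq nat * nat) := has (fun i => key.2 < i)%N key.1.

Lemma good_sorted key : sorted leq key.1 -> ~~ descent key ->
  sort leq (rcons key.1 key.2) = rcons key.1 key.2.
Proof.
move=> sk nb; apply: sorted_sort; first exact: leq_trans.
rewrite -cats1 (sorted_pairwise leq_trans) pairwise_cat /= -(sorted_pairwise leq_trans).
rewrite sk !andbT allrel1r; move: nb; rewrite /descent -all_predC.
by apply: sub_all => i /=; rewrite -leqNgt.
Qed.

Lemma gen_coef_short j u key : (size key.1 < size u)%N -> gen_coef j u key = 0.
Proof.
by move=> su; rewrite /gen_coef !split_coef_short ?subrr // ?size_sort size_rcons.
Qed.

Lemma gen_coef_good j u key : sorted leq key.1 -> ~~ descent key -> gen_coef j u key = 0.
Proof. by move=> sk nb; rewrite /gen_coef good_sorted ?subrr. Qed.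

(** A prefix as long as [key.1] forces the split at the last letter. The sorted word ends in its
    largest letter, which cannot be j because some letter of u exceeds j; so only the unsorted word
    contributes. *)
Lemma gen_coef_top j u key : size key.1 = size u -> sorted leq u -> sorted leq key.1 ->
  descent (u, j) -> gen_coef j u key = (key == (u, j))%:R.
Proof.
case: key => t k /= st su ss bu; rewrite /gen_coef split_coef_rcons //=.
case/lastP E : (sort leq (rcons t k)) => [|v l].
  by have := congr1 size E; rewrite size_sort size_rcons.
have sv : size u = size v.
  by have := congr1 size E; rewrite size_sort !size_rcons st => -[].
rewrite split_coef_rcons //.
have -> : (l == j) && perm_eq v u = false.
  apply/negP => /andP [/eqP lj pvu].
  have := sort_sorted leq_total (rcons t k); rewrite E -cats1.
  rewrite (sorted_pairwise leq_trans) pairwise_cat allrel1r => /andP [/allP vl _].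
  case/hasP: bu => i /= iu; rewrite ltnNge => /negP; apply; rewrite -lj; apply: vl.
  by rewrite (perm_mem pvu).
rewrite subr0 xpair_eqE andbC; congr ((_ && _)%:R).
apply/idP/eqP => [|->//]; exact: (sorted_eq leq_trans anti_leq).
Qed.

End SplitCoefficients.

Lemma dev_schreier (charK0 : [pchar K] =i pred0) N (x : nat -> grass K N) f j :
  peq f (schreier_sum f) ->
  (forall alpha : nat -> K,
     dev (fun i => alpha i *: 1) (fun i => (i == j)%:R) x f = 0) ->
  forall u, \sum_(key <- schreier_keys f)
     gen_coef x j u key * ev x (schreier_coef f key) = 0.
Proof.
move=> pf dz u; apply/ffunP => S; rewrite ffunE.
(* For a fixed coordinate S the (1,2) entry becomes a polynomial in alpha over [K], represented by
   [h]. *)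
pose part k w key : ncpoly K := [seq (k * (mon x e.2 * ev x (schreier_coef f key)) S, e.1)
  | e <- splits j w].
pose h : ncpoly K := flatten [seq part 1 (rcons key.1 key.2) key ++
  part (-1) (sort leq (rcons key.1 key.2)) key | key <- schreier_keys f].
have hz alpha : \sum_(t <- h) t.1 * \prod_(i <- t.2) alpha i = 0.
  have := dz alpha; rewrite /dev (lsum_peq _ pf) /schreier_sum lsum_flatten big_map.
  move/(congr1 (fun y : grass K N => y S)); rewrite ffunE sum_ffunE => e.
  rewrite -[RHS]e big_flatten big_map; apply: eq_bigr => key _.
  rewrite -/(dev _ _ _ _) dev_mul ev_schreier_gen.
  (* Both words have the same commutative value, so b_(t,k) has diagonal entry 0 and its (1,2) entry
     multiplies g_(t,k). *)
  have -> : mon (fun i => alpha i *: 1 : grass K N) (rcons key.1 key.2) =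
     mon (fun i => alpha i *: 1) (sort leq (rcons key.1 key.2)).
    by rewrite !mon_scalar; congr (_ *: _); apply: perm_big; rewrite perm_sym perm_sort.
  rewrite subrr mul0r add0r dev_add dev_scale scaleN1r /dev !lsum_word !scale1r.
  rewrite !dmon_splits mulrBl ffunE [X in _ + X]ffunE big_cat /= !big_map.
  rewrite !mulr_suml !sum_ffunE -sumrN; congr (_ + _); apply: eq_bigr => e' _ /=.
    by rewrite mul1r -scalerAl [RHS]ffunE mulrC.
  by rewrite mulN1r mulNr -scalerAl; congr (- _); rewrite [RHS]ffunE mulrC.
have := monomial_coef_eq0 charK0 hz u; rewrite /h big_flatten big_map => e.
rewrite -[RHS]e sum_ffunE; apply: eq_bigr => key _.
rewrite big_cat /= !big_map /= /gen_coef mulrBl /split_coef !mulr_suml.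
rewrite ffunE [X in _ + X]ffunE !sum_ffunE -sumrN; congr (_ + _); apply: eq_bigr => e' _.
  by rewrite mul1r.
by rewrite mulN1r.
Qed.

(** Descending induction on |t|. In the coefficient of alpha^u, keys shorter than u contribute 0,
    longer ones vanish by induction, and among those of equal length only (u, j) survives. *)
Lemma schreier_coef0 (charK0 : [pchar K] =i pred0) N (x : nat -> grass K N) f :
  peq f (schreier_sum f) ->
  (forall (alpha : nat -> K) j,
     dev (fun i => alpha i *: 1) (fun i => (i == j)%:R) x f = 0) ->
  forall key, sorted leq key.1 -> descent key -> ev x (schreier_coef f key) = 0.
Proof.
move=> pf dz.
pose B := \max_(key <- schreier_keys f) size key.1.
suff H d key : (B < size key.1 + d)%N -> sorted leq key.1 -> descent key ->
    ev x (schreier_coef f key) = 0.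
  by move=> key; apply: (H B.+1); rewrite addnS ltnS leq_addl.
have nokey k : k \notin schreier_keys f -> ev x (schreier_coef f k) = 0.
  rewrite mem_undup => nk; rewrite /schreier_coef (_ : [seq e <- _ | _] = [::]) ?ev_zero //.
  apply/eqP; rewrite -[_ == _]negbK -has_filter; apply: contra nk => /hasP [e es /eqP <-].
  exact: (map_f (fun e : K * ((seq nat * nat) * seq nat) => e.2.1)).
elim: d key => [|d IH] [u j] /= Bd su bu.
  apply: nokey; apply/negP => kin; move: Bd; rewrite addn0 ltnNge => /negP; apply.
  exact: (@leq_bigmax_seq _ _ predT (fun key : seq nat * nat => size key.1) (u, j)).
have [kin|] := boolP ((u, j) \in schreier_keys f); last exact: nokey.
have := dev_schreier charK0 pf (fun alpha => dz alpha j) u.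
rewrite (bigD1_seq (u, j)) ?undup_uniq //= gen_coef_top // eqxx mul1r.
rewrite big_seq_cond big1 ?addr0 // => key /andP [kk nk].
have sk := schreier_keys_sorted kk.
have [lt|gt|eq] := ltngtP (size key.1) (size u).
- by rewrite gen_coef_short // mul0r.
- have [bk|nb] := boolP (descent key); last by rewrite gen_coef_good // mul0r.
  rewrite IH ?mulr0 //; apply: leq_trans Bd _.
  by rewrite addnS -addSn leq_add2r.
- by rewrite gen_coef_top // (negPf nk) mul0r.
Qed.

Lemma sorted_part0 (V : lmodType K) (h : seq nat -> V) (f : ncpoly K) :
  (forall u, \sum_(t <- f | perm_eq t.2 u) t.1 = 0) ->
  \sum_(t <- f) t.1 *: h (sort leq t.2) = 0.
Proof.
move=> z; have := @key_sum0 K _ V h [seq (t.1, sort leq t.2) | t <- f] predT.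
rewrite big_map /= => -> // k _; rewrite big_map /=.
have [<-|nk] := eqVneq (sort leq k) k.
  by rewrite -[RHS](z k); apply: eq_bigl => t; rewrite sort_eq_perm.
rewrite big1 // => t /eqP e; case/eqP: nk; rewrite -e.
by apply/eqP; rewrite sort_eq_perm perm_sort.
Qed.

End Schreier.

(** * The identities of F_n(A) lie in J, and conclusion *)

Lemma T_Fn_sub (K : fieldType) (charK0 : [pchar K] =i pred0) n (f : ncpoly K) :
  (1 <= n)%N -> ~~ odd n -> T_Fn n f ->
  T_ideal_gen (fun g => g = @gen1 K \/ g = @gen2 K n) f.
Proof.
move=> n1 en Tf; have n2 : (1 < n)%N by case: n n1 en {Tf} => [|[|n]].
have e2 : n./2.*2 = n by rewrite even_halfK.
have fz u : \sum_(t <- f | perm_eq t.2 u) t.1 = 0.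
  apply: (monomial_coef_eq0 charK0) => alpha.
  (* The (1,1) entry evaluates [f] at arbitrary commuting scalars. *)
  have [|H _] := T_Fn_point charK0 n2 (s := [::]) _ alpha alpha 0 Tf; first by [].
  move: H; rewrite /ev /lsum; under eq_bigr do rewrite mon_scalar scalerA.
  by move/eqP; rewrite -scaler_suml scaler_eq0 oner_eq0 orbF => /eqP.
have sumz (R : algType K) (x : nat -> R) : \sum_(t <- f) t.1 *: mon x (sort leq t.2) = 0.
  exact: sorted_part0.
(* Equal values at the free generators mean equal polynomials; this makes the decomposition
   available for [dev] as well. *)
have pf : peq f (schreier_sum f).
  apply: ev_fvar_inj; rewrite ev_schreier_all // /schreier_sum /ev lsum_flatten big_map.
  by apply: eq_bigr => key _; rewrite -!/(ev _ _) ev_mul.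
apply/TgenE; rewrite ev_schreier_all //.
rewrite big_seq; apply: (ideal_sum (Tgen_ideal _)) => key /schreier_keys_sorted sk.
rewrite ev_schreier_gen.
have [bk|nb] := boolP (descent key); last first.
  by rewrite good_sorted // subrr mul0r; apply: (ideal0 (Tgen_ideal _)).
apply: J_perm; last by rewrite perm_sym perm_sort.
(* With 2(n/2) = n Grassmann generators, g_(t,k) is shown to lie in [Jres]. *)
apply: (grassmann_identities charK0 (m := n./2)).
- exact: Jres_ideal.
- exact: Jres_lie.
- exact: Jres_prod.
rewrite e2 => s r ss es sn.
apply: (schreier_coef0 charK0 pf) => // alpha j.
by have [] := T_Fn_point charK0 n2 sn r alpha j Tf.
Qed.

Theorem theorem3p1 (K : fieldType) (charK0 : [pchar K] =i pred0)
    (n : nat) (n_ge1 : (1 <= n)%N) (n_even : ~~ odd n) :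
  (forall f : ncpoly K,
     T_Fn n f <-> T_ideal_gen (fun g => g = @gen1 K \/ g = @gen2 K n) f) /\
  (forall f : ncpoly K, T_Fn n f <-> T_Fn n.+1 f).
Proof.
have char2 : 2%:R != 0 :> K by rewrite (pcharf0P K).1.
(* The inclusions of T(F_n(A)) in J, of J in T(F_(n+1)(A)) and of the latter in T(F_n(A)) close a
   cycle, which gives both claims. *)
have up f : T_ideal_gen (fun g => g = @gen1 K \/ g = @gen2 K n) f -> T_Fn n.+1 f.
  exact: T_gen_sub.
have down (f : ncpoly K) : T_Fn n.+1 f -> T_Fn n f by apply: T_Fn_leq.
have sub (f : ncpoly K) := @T_Fn_sub K charK0 n f n_ge1 n_even.
split=> f; split=> [/sub //|].
- by move=> /up /down.
- by move=> /up.
- exact: down.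
Qed.
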